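(* Let $q$ be a complex number with $0<|q|<1$. Define $R(q) = \dfrac{(q,q^4;q^5)_\infty}{(q^2,q^3;q^5)_\infty}$ and $R_m := R(q^m)$ for positive integers $m$. Then \[ q\frac{(q;q)_{\infty}^6}{(q^5;q^5)_{\infty}^6}=\frac{P(R_1,R_2,R_4)}{R_1^4R_2R_4^2}, \] where \begin{align*} P(a,b,c) &:= q^4(-2 a^8 b^2 c^3 + a^8 c^4 - 2 a^6 b c^4 - 5 a^4 b^2 c^4) \\ &\quad+ q^3(-a^7 b^2 c^2 - 2 a^7 c^3+ 6 a^5 b c^3 - 6 a^3 b^2 c^3 + 3 a^3 c^4 - a b c^4) \\ &\quad+ q^2(2 a^8 b c + 4 a^6 b^2 c - 2 a^6 c^2 + 5 a^4 b c^2+ 2 a^2 b^2 c^2 + 4 a^2 c^3 - 2 b c^3)\\ &\quad+q(a^7 b + 3 a^5 b^2 + 6 a^5 c + 6 a^3 b c + 2 a b^2 c - a c^2)+5 a^4 - 2 a^2 b - b^2 - 2 c. \end{align*}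
   Context: For complex $a,q$ with $|q|<1$, $(a;q)_\infty := \prod_{n=0}^\infty (1-aq^n)$ and $(a_1,\ldots,a_m;q)_\infty := (a_1;q)_\infty\cdots(a_m;q)_\infty$. The function $R(q)$ is the Rogers–Ramanujan continued fraction $\frac{1}{1+\frac{q}{1+\frac{q^2}{1+\cdots}}}$, which equals the stated infinite product. The identity may equivalently be read as an identity of formal power series/Laurent series in $q$. *)

(* Defs.v *)
From mathcomp Require Import all_boot all_order all_algebra.
From mathcomp Require Import all_classical all_reals all_analysis.
Import Order.TTheory GRing.Theory Num.Theory.
Import numFieldNormedType.Exports.

Set Implicit Arguments.
Unset Strict Implicit.
Unset Printing Implicit Defensive.

Local Open Scope classical_set_scope.
Local Open Scope ring_scope.

(* The definitions are over a numFieldType C because that is where the library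
   provides the norm topology used by lim; they are meant for C := R[i] with
   R : realType. *)

(* lim is total: the value is the infinite product when the partial products
   converge, as they do in R[i] for `|q| < 1. *)
Definition qpoch (C : numFieldType) (a q : C) : C :=
  lim ((\prod_(0 <= k < n) (1 - a * q ^+ k)) @[n --> \oo]).

Definition qpochs (C : numFieldType) (s : seq C) (q : C) : C :=
  \prod_(a <- s) qpoch a q.

Definition RR (C : numFieldType) (q : C) : C :=
  qpochs [:: q; q ^+ 4] (q ^+ 5) / qpochs [:: q ^+ 2; q ^+ 3] (q ^+ 5).

Definition RRm (C : numFieldType) (q : C) (m : nat) : C := RR (q ^+ m).

Definition P (C : numFieldType) (q a b c : C) : C :=
  q ^+ 4 * (- 2 * a ^+ 8 * b ^+ 2 * c ^+ 3 + a ^+ 8 * c ^+ 4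
            - 2 * a ^+ 6 * b * c ^+ 4 - 5 * a ^+ 4 * b ^+ 2 * c ^+ 4)
  + q ^+ 3 * (- (a ^+ 7 * b ^+ 2 * c ^+ 2) - 2 * a ^+ 7 * c ^+ 3
              + 6 * a ^+ 5 * b * c ^+ 3 - 6 * a ^+ 3 * b ^+ 2 * c ^+ 3
              + 3 * a ^+ 3 * c ^+ 4 - a * b * c ^+ 4)
  + q ^+ 2 * (2 * a ^+ 8 * b * c + 4 * a ^+ 6 * b ^+ 2 * c
              - 2 * a ^+ 6 * c ^+ 2 + 5 * a ^+ 4 * b * c ^+ 2
              + 2 * a ^+ 2 * b ^+ 2 * c ^+ 2 + 4 * a ^+ 2 * c ^+ 3
              - 2 * b * c ^+ 3)
  + q * (a ^+ 7 * b + 3 * a ^+ 5 * b ^+ 2 + 6 * a ^+ 5 * c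
         + 6 * a ^+ 3 * b * c + 2 * a * b ^+ 2 * c - a * c ^+ 2)
  + 5 * a ^+ 4 - 2 * a ^+ 2 * b - b ^+ 2 - 2 * c.

(* Main.v *)
(* The proof lives on modular curves of levels 10 and 20, but uses only theta
   products. Put [th n q k = (q^k, q^(n-k); q^n)_oo], [a = R(q)], [b = R(q^2)],
   [c = R(q^4)], [k = q a b^2] and [m = q^2 b c^2]. The Jacobi triple product
   splits [theta(xy) theta(x/y)] into two products of a function of [x] by a
   function of [y], so these products satisfy a Pluecker relation, which is the
   three-term relation of Weierstrass. Five instances of it, combined with
   product rearrangements, give
     b (1 - k) = a^2 (1 + k),   c (1 - m) = b^2 (1 + m),
     (k + m)^2 = m (1 - k^2),
     (q;q)^6 / (q^5;q^5)^6
       = q (1 - 4k - k^2)^2 (1 + k - k^2) / (k (1 - k^2)^2).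
   The first two equations express [b], [c] and [q] through [a], [k], [m], and
   the theorem becomes a polynomial identity modulo the third one. *)
Require Import Defs.
From mathcomp Require Import all_boot all_order all_algebra.
From mathcomp Require Import all_classical all_reals all_analysis complex.
From mathcomp Require Import zify ring.
Import Order.TTheory GRing.Theory Num.Theory.
Import numFieldNormedType.Exports.

Set Implicit Arguments.
Unset Strict Implicit.
Unset Printing Implicit Defensive.

Local Open Scope classical_set_scope.
Local Open Scope ring_scope.

(** * Unordered sums *)

Section UnorderedSums.
Variable C : numFieldType.

Lemma cvg_eq (u : nat -> C) (a b : C) :
  u n @[n --> \oo] --> a -> a = b -> u n @[n --> \oo] --> b.
Proof. by move=> ua <-. Qed.

Lemma cvg_ext (u v : nat -> C) (a : C) :
  u =1 v -> u n @[n --> \oo] --> a -> v n @[n --> \oo] --> a.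
Proof. by move=> /funext <-. Qed.

(** Convergence along the directed family of finite subsets, encoded as duplicate-free lists. Sums
    over [int] and over pairs then need no enumeration, and bijective reindexing is immediate. *)
Definition hassum (I : eqType) (f : I -> C) (S : C) : Prop :=
  forall e, 0 < e -> exists A : seq I,
    forall s, uniq s -> {subset A <= s} -> `|S - \sum_(i <- s) f i| < e.

Definition abs_summable (I : eqType) (f : I -> C) : Prop :=
  exists M, forall s : seq I, uniq s -> \sum_(i <- s) `|f i| <= M.

(* A form of completeness that makes sense over an arbitrary numFieldType;
   it also provides the archimedean-type facts needed below. *)
Definition abs_complete : Prop :=
  forall (I : eqType) (f : I -> C), abs_summable f -> exists S, hassum f S.

Lemma ler_sum_subset (I : eqType) (F : I -> C) (s t : seq I) :
  (forall i, 0 <= F i) -> uniq s -> {subset s <= t} ->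
  \sum_(i <- s) F i <= \sum_(i <- t) F i.
Proof.
move=> F0; elim: s t => [|x s IH] t /=; first by rewrite big_nil sumr_ge0.
move=> /andP[xs us] st; have xt : x \in t by apply: st; rewrite inE eqxx.
rewrite big_cons (perm_big _ (perm_to_rem xt)) big_cons lerD2l IH // => i si.
have ix : i != x by apply: contraNneq xs => <-.
have : i \in t by apply: st; rewrite inE si orbT.
by rewrite (perm_mem (perm_to_rem xt)) inE (negPf ix).
Qed.

Lemma hassum_unique (I : eqType) (f : I -> C) (S T : C) :
  hassum f S -> hassum f T -> S = T.
Proof.
move=> hS hT; apply/eqP; rewrite -subr_eq0 -normr_le0.
apply/negPn/negP => H.
have e0 : 0 < `|S - T| / 2.
  by rewrite divr_gt0 // normr_gt0; apply: contraNneq H => ->; rewrite normr0.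
have [A hA] := hS _ e0; have [B hB] := hT _ e0.
pose s := undup (A ++ B).
have us : uniq s by apply: undup_uniq.
have /(hA _ us) h1 : {subset A <= s}.
  by move=> i iA; rewrite mem_undup mem_cat iA.
have /(hB _ us) h2 : {subset B <= s}.
  by move=> i iB; rewrite mem_undup mem_cat iB orbT.
have := ltrD h1 h2; rewrite -splitr.
rewrite [X in _ + X < _]distrC => h.
by have := lt_le_trans h (ler_distD (\sum_(i <- s) f i) S T); rewrite ltxx.
Qed.

Lemma eq_hassum (I : eqType) (f g : I -> C) (S : C) :
  f =1 g -> hassum f S -> hassum g S.
Proof.
move=> fg hf e /hf[A hA]; exists A => s us As.
by have := hA s us As; under eq_bigr do rewrite fg.
Qed.

Lemma hassumZ (I : eqType) (f : I -> C) (S c : C) :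
  hassum f S -> hassum (fun i => c * f i) (c * S).
Proof.
move=> hf e e0; have [->|c0] := eqVneq c 0.
  exists [::] => s _ _; under eq_bigr do rewrite mul0r.
  by rewrite big1 // mul0r subr0 normr0.
have nc0 : 0 < `|c| by rewrite normr_gt0.
have [A hA] := hf (e / `|c|) (divr_gt0 e0 nc0); exists A => s us As.
by rewrite -mulr_sumr -mulrBr normrM mulrC -ltr_pdivlMr // hA.
Qed.

Lemma hassumB (I : eqType) (f g : I -> C) (S T : C) :
  hassum f S -> hassum g T -> hassum (fun i => f i - g i) (S - T).
Proof.
move=> hS hT e e0; have e20 : 0 < e / 2 by rewrite divr_gt0.
have [A hA] := hS _ e20; have [B hB] := hT _ e20.
exists (A ++ B) => s us ABs; rewrite sumrB opprB.
have h1 : `|S - \sum_(i <- s) f i| < e / 2.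
  by apply: hA => // i iA; apply: ABs; rewrite mem_cat iA.
have h2 : `|T - \sum_(i <- s) g i| < e / 2.
  by apply: hB => // i iB; apply: ABs; rewrite mem_cat iB orbT.
have -> : S - T + (\sum_(i <- s) g i - \sum_(i <- s) f i) =
    (S - \sum_(i <- s) f i) - (T - \sum_(i <- s) g i) by ring.
apply: le_lt_trans (ler_normB _ _) _.
by rewrite [ltRHS]splitr ltrD.
Qed.

Lemma hassum_reindex (I J : eqType) (h : J -> I) (f : I -> C) (S : C) :
  bijective h -> hassum f S -> hassum (f \o h) S.
Proof.
move=> [g hK gK] hf e /hf[A hA]; exists (map g A) => s us As.
have := hA (map h s); rewrite big_map; apply.
  by rewrite (map_inj_uniq (can_inj hK)).
by move=> i iA; apply/mapP; exists (g i); rewrite ?gK //; apply/As/map_f.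
Qed.

(** Serves to reassemble a sum over pairs of integers from its two parity classes; [pmap l] and
    [pmap r] separate a finite set into its two halves. *)
Lemma hassum_inlr (I J : eqType) (f : I + J -> C) (S T : C) :
  hassum (fun i => f (inl i)) S -> hassum (fun j => f (inr j)) T ->
  hassum f (S + T).
Proof.
move=> hS hT e e0; have e20 : 0 < e / 2 by rewrite divr_gt0.
have [A hA] := hS _ e20; have [B hB] := hT _ e20.
exists (map inl A ++ map inr B) => s us ABs.
pose l (x : I + J) := if x is inl i then Some i else None.
pose r (x : I + J) := if x is inr j then Some j else None.
have ll : pcancel inl l by [].
have rr : pcancel inr r by [].
have lo : ocancel l inl by case.
have ro : ocancel r inr by case.
have -> : \sum_(i <- s) f i =
    \sum_(i <- pmap l s) f (inl i) + \sum_(i <- pmap r s) f (inr i).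
  elim: s {us ABs} => [|[i|j] s IH]; first by rewrite !big_nil addr0.
    by rewrite !big_cons IH /= addrA.
  by rewrite !big_cons IH /= addrCA.
have h1 : `|S - \sum_(i <- pmap l s) f (inl i)| < e / 2.
  apply: hA; first exact: (pmap_uniq lo).
  move=> i iA; rewrite mem_pmap; apply/mapP; exists (inl i) => //.
  by apply: ABs; rewrite mem_cat map_f.
have h2 : `|T - \sum_(i <- pmap r s) f (inr i)| < e / 2.
  apply: hB; first exact: (pmap_uniq ro).
  move=> i iB; rewrite mem_pmap; apply/mapP; exists (inr i) => //.
  by apply: ABs; rewrite mem_cat [in X in _ || X]map_f ?orbT.
rewrite opprD addrACA; apply: le_lt_trans (ler_normD _ _) _.
by rewrite [ltRHS]splitr ltrD.
Qed.

(** Completeness gives the norms a sum [T]. The partial sums over [A] and over [A] enlarged by a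
    disjoint [s] both lie within [e / 2] of [T], so their difference is below [e]. *)
Lemma abs_summable_tail (I : eqType) (f : I -> C) (e : C) :
  abs_complete -> abs_summable f -> 0 < e ->
  exists A : seq I, forall s, uniq s -> (forall i, i \in s -> i \notin A) ->
    \sum_(i <- s) `|f i| < e.
Proof.
move=> cC [M hM] e0; have [|T hT] := cC I (fun i => `|f i|).
  by exists M => s us; under eq_bigr do rewrite normr_id; exact: hM.
have e20 : 0 < e / 2 by rewrite divr_gt0.
have [A hA] := hT _ e20; exists A => s us sA.
have h1 : `|T - \sum_(i <- undup A) `|f i| | < e / 2.
  by apply: hA; [exact: undup_uniq | move=> i; rewrite mem_undup].
have h2 : `|T - \sum_(i <- undup A ++ s) `|f i| | < e / 2.
  apply: hA; last by move=> i; rewrite mem_cat mem_undup => ->.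
  rewrite cat_uniq undup_uniq us andbT; apply/hasPn => i /sA.
  by rewrite mem_undup.
rewrite big_cat /= in h2.
set a := \sum_(i <- s) _; have a0 : 0 <= a by rewrite sumr_ge0.
have -> : a = `|(T - \sum_(i <- undup A) `|f i|) -
    (T - (\sum_(i <- undup A) `|f i| + a))|.
  by rewrite opprB addrC addrA subrK addrAC subrr add0r ger0_norm.
by apply: le_lt_trans (ler_normB _ _) _; rewrite [ltRHS]splitr ltrD.
Qed.

(** A finite set of pairs lies in the rectangle of its two projections, over which the sum of norms
    factors. *)
Lemma abs_summable_pair (I J : eqType) (f : I -> C) (g : J -> C) :
  abs_summable f -> abs_summable g ->
  abs_summable (fun z : I * J => f z.1 * g z.2).
Proof.
move=> [M hM] [N hN]; exists (M * N) => s us.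
pose a := undup (unzip1 s); pose b := undup (unzip2 s).
apply: (@le_trans _ _ (\sum_(z <- [seq (x, y) | x <- a, y <- b])
    `|f z.1 * g z.2|)).
  apply: ler_sum_subset => // -[x y] xys; rewrite allpairs_f // mem_undup.
    by apply/mapP; exists (x, y).
  by apply/mapP; exists (x, y).
rewrite big_allpairs /=.
under eq_bigr do under eq_bigr do rewrite normrM.
under eq_bigr do rewrite -mulr_sumr.
rewrite -mulr_suml ler_pM ?sumr_ge0 //; [apply: hM|apply: hN];
  exact: undup_uniq.
Qed.

(** Completeness yields some sum [V] of the double family; large rectangles, on which partial sums
    factor, force [V = S * T]. *)
Lemma hassum_pair (I J : eqType) (f : I -> C) (g : J -> C) (S T : C) :
  abs_complete -> abs_summable f -> abs_summable g ->
  hassum f S -> hassum g T -> hassum (fun z : I * J => f z.1 * g z.2) (S * T).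
Proof.
move=> cC af ag hf hg; have [V hV] := cC _ _ (abs_summable_pair af ag).
suff -> : S * T = V by [].
apply/eqP; rewrite -subr_eq0 -normr_le0; apply/negPn/negP => H.
set d := `|S * T - V| in H.
have d0 : 0 < d.
  by rewrite normr_gt0; apply: contraNneq H => h; rewrite /d h normr0.
(* The error on a rectangle will be at most [e * K]: the norms of [S] and [T] weigh the two linear
   errors, and the 1 covers their product, which is where [e <= 1] enters. *)
pose K := `|S| + `|T| + 1.
have K0 : 0 < K by rewrite ltr_wpDl ?addr_ge0.
pose e := Num.min 1 (d / 2 / K).
have e'0 : 0 < d / 2 / K by rewrite !divr_gt0.
(* The order of a [numFieldType] is partial, so the laws of [Num.min] require comparable
   arguments. *)
have cmp : (1 : C) >=< d / 2 / K.
  by rewrite real_comparable ?realE ?ler01 // (ltW e'0).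
have e0 : 0 < e by rewrite comparable_lt_min // ltr01.
have e1 : e <= 1 by rewrite comparable_ge_min // lexx.
have e2 : e <= d / 2 / K by rewrite comparable_ge_min // lexx orbT.
have [A hA] := hf _ e0; have [B hB] := hg _ e0.
have d20 : 0 < d / 2 by rewrite divr_gt0.
have [D hD] := hV _ d20.
pose a := undup (A ++ unzip1 D); pose b := undup (B ++ unzip2 D).
have ha : `|S - \sum_(i <- a) f i| < e.
  apply: hA; first exact: undup_uniq.
  by move=> i iA; rewrite mem_undup mem_cat iA.
have hb : `|T - \sum_(i <- b) g i| < e.
  apply: hB; first exact: undup_uniq.
  by move=> i iA; rewrite mem_undup mem_cat iA.
have : `|V - \sum_(z <- [seq (x, y) | x <- a, y <- b]) f z.1 * g z.2| < d / 2.
  apply: hD; first by apply: allpairs_uniq; rewrite ?undup_uniq // => -[? ?] [].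
  move=> -[x y] xyD; rewrite allpairs_f // mem_undup mem_cat; apply/orP; right.
    by apply/mapP; exists (x, y).
  by apply/mapP; exists (x, y).
rewrite big_allpairs /=; under eq_bigr do rewrite -mulr_sumr.
rewrite -mulr_suml.
set s := \sum_(i <- a) f i in ha *; set t := \sum_(i <- b) g i in hb *.
move=> hst.
have hK : `|S * T - s * t| <= e * K.
  have -> : S * T - s * t = (S - s) * T + S * (T - t) - (S - s) * (T - t).
    by ring.
  apply: le_trans (ler_normB _ _) _;
    rewrite /K [leRHS]mulrDr [X in _ <= _ + X]mulr1.
  apply: lerD; last first.
    rewrite normrM -[leRHS]mulr1 ler_pM // ?(ltW ha) //.
    by apply: le_trans (ltW hb) e1.
  apply: le_trans (ler_normD _ _) _; rewrite !normrM mulrDr addrC lerD //.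
    by rewrite mulrC ler_wpM2r // ltW.
  by rewrite ler_wpM2r // ltW.
have : d < d.
  rewrite {1}/d; apply: le_lt_trans (ler_distD (s * t) _ _) _.
  rewrite [ltRHS]splitr ler_ltD //; last by rewrite distrC.
  by apply: le_trans hK _; rewrite -ler_pdivlMr.
by rewrite ltxx.
Qed.

(** Tannery's theorem (dominated convergence). In [c n i = L + (c n i - L)] the second part
    contributes little: on a finite set by pointwise convergence, off it because the coefficients
    are bounded and the tail of [f] is small. *)
Lemma hassum_tannery (I : eqType) (f : I -> C) (S : C) (c : nat -> I -> C)
    (L K : C) (s : nat -> seq I) :
  abs_complete -> abs_summable f -> hassum f S ->
  (forall n, uniq (s n)) -> (forall i, \forall n \near \oo, i \in s n) ->
  0 <= K -> (forall n i, `|c n i| <= K) ->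
  (forall i, c n i @[n --> \oo] --> L) ->
  \sum_(i <- s n) c n i * f i @[n --> \oo] --> L * S.
Proof.
move=> cC af hf us es K0 cK cL.
have near_sub (A : seq I) : \forall n \near \oo, {subset A <= s n}.
  elim: A => [|x A IH]; first by near=> n.
  near=> n; move=> i; rewrite inE => /orP[/eqP->|].
    by near: n; exact: es.
  by move: i; near: n; exact: IH.
have h1 : \sum_(i <- s n) L * f i @[n --> \oo] --> L * S.
  apply/cvgrPdist_lt => e /(hassumZ L hf)[A hA]; near=> n.
  by apply: hA => //; near: n; exact: near_sub.
have h2 : \sum_(i <- s n) (c n i - L) * f i @[n --> \oo] --> 0.
  apply/cvgrPdist_lt => e e0.
  pose K' := K + `|L| + 1.
  have K'0 : 0 < K' by rewrite ltr_wpDl ?addr_ge0.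
  have [|A hA] := abs_summable_tail cC af (e := e / 2 / K').
    by rewrite !divr_gt0.
  have hfin : \sum_(i <- A) `|(c n i - L) * f i| @[n --> \oo] --> 0.
    elim: (A) => [|x B IH].
      by under eq_fun do rewrite big_nil; exact: cvg_cst.
    under eq_fun do rewrite big_cons.
    have h3 : (c n x - L) * f x @[n --> \oo] --> 0.
      rewrite -(mul0r (f x)); apply: cvgM; last exact: cvg_cst.
      by rewrite -(subrr L); apply: cvgB => //; exact: cvg_cst.
    by apply: (cvg_eq (cvgD (cvg_norm h3) IH)); rewrite normr0 addr0.
  have e20 : 0 < e / 2 by rewrite divr_gt0.
  have /cvgrPdist_lt/(_ _ e20) hfin' := hfin.
  near=> n; rewrite sub0r normrN.
  rewrite (bigID (mem A)) /=; apply: le_lt_trans (ler_normD _ _) _.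
  rewrite [ltRHS]splitr; apply: ltr_leD.
    apply: le_lt_trans (ler_norm_sum _ _ _) _.
    have : `|0 - \sum_(i <- A) `|(c n i - L) * f i| | < e / 2 by near: n.
    rewrite sub0r normrN ger0_norm ?sumr_ge0 //; apply: le_lt_trans.
    rewrite -big_filter; apply: ler_sum_subset; rewrite ?filter_uniq //.
    by move=> i; rewrite mem_filter => /andP[].
  apply: le_trans (ler_norm_sum _ _ _) _; rewrite -big_filter.
  set t := [seq _ <- _ | _].
  apply: (@le_trans _ _ (\sum_(i <- t) K' * `|f i|)).
    apply: ler_sum => i _; rewrite normrM ler_wpM2r //.
    apply: le_trans (ler_normB _ _) _; rewrite /K' -[leLHS]addr0.
    by rewrite !lerD.
  rewrite -mulr_sumr mulrC -ler_pdivlMr //; apply/ltW/hA.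
    by rewrite filter_uniq.
  by move=> i; rewrite mem_filter => /andP[].
rewrite -[L * S]addr0.
have -> : (fun n => \sum_(i <- s n) c n i * f i) =
    (fun n => \sum_(i <- s n) L * f i + \sum_(i <- s n) (c n i - L) * f i).
  apply/funext => n; rewrite -big_split /=; apply: eq_bigr => i _.
  by rewrite -mulrDl addrCA subrr addr0.
exact: cvgD.
Unshelve. all: by end_near.
Qed.
End UnorderedSums.

(** * Absolute completeness of the real and the complex numbers *)

Section Completeness.
Variable R : realType.

(** The sum is the supremum of the finite partial sums. *)
Lemma hassum_nonneg (I : eqType) (f : I -> R) (M : R) :
  (forall i, 0 <= f i) ->
  (forall s : seq I, uniq s -> \sum_(i <- s) f i <= M) -> exists S, hassum f S.
Proof.
move=> f0 fM; pose E := [set x : R | exists2 s : seq I, uniq s & x = \sum_(i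
  <- s) f i].
have supE : has_sup E.
  split; first by exists 0, [::] => //; rewrite big_nil.
  by exists M => _ [s us ->]; exact: fM.
exists (sup E) => e e0; have [_ [A uA ->] hA] := sup_adherent e0 supE.
exists A => s us As.
have le1 : \sum_(i <- A) f i <= \sum_(i <- s) f i by exact: ler_sum_subset.
have le2 : \sum_(i <- s) f i <= sup E by apply: sup_upper_bound => //; exists s.
by rewrite ger0_norm ?subr_ge0 // ltrBlDr -ltrBlDl (lt_le_trans hA).
Qed.

(** [f] is the difference of [|f| + f] and [|f|], both nonnegative with bounded partial sums. *)
Lemma real_abs_complete : abs_complete R.
Proof.
move=> I f [M fM].
have [|s us|S hS] := @hassum_nonneg I (fun i => `|f i| + f i) (M + M).
- by move=> i; rewrite -lerBlDl sub0r lerNl -normrN ler_norm.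
- rewrite big_split lerD ?fM //.
  by apply: le_trans (fM s us); apply: ler_sum => i _; exact: ler_norm.
have [//|T hT] := @hassum_nonneg I (fun i => `|f i|) M _ fM.
exists (S - T); apply: eq_hassum (hassumB hS hT) => i.
by rewrite addrAC subrr add0r.
Qed.

Local Open Scope complex_scope.

(** Real and imaginary parts are dominated by the norm, so the real case applies to each. *)
Lemma complex_abs_complete : abs_complete (R[i] : numFieldType).
Proof.
move=> I f [M fM].
have norm_le (z : R[i]) : `|z| <= (`|complex.Re z| + `|complex.Im z|)%:C.
  case: z => a b /=; rewrite normc_def lecR /= -(@ler_pXn2r _ 2) ?nnegrE //.
  rewrite sqr_sqrtr ?addr_ge0 ?sqr_ge0 //.
  rewrite sqrrD !real_normK ?num_real // lerD2r lerDl.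
  by rewrite mulrn_wge0 // mulr_ge0.
have normc_ge_Im (z : R[i]) : `|complex.Im z|%:C <= `|z|.
  case: z => a b /=; rewrite normc_def lecR /= -sqrtr_sqr ler_sqrt ?lerDr
    ?sqr_ge0 //.
  by rewrite addr_ge0 ?sqr_ge0.
have M0 : 0 <= M by have := fM [::] isT; rewrite big_nil.
have bnd (g : I -> R) : (forall i, `|g i|%:C <= `|f i|) -> abs_summable g.
  move=> gf; exists (complex.Re M) => s us; rewrite -lecR.
  rewrite -[X in _ <= X](_ : M = _); last first.
    by move: M0; case: (M) => a b; rewrite lecE /= => /andP[/eqP->].
  apply: le_trans (fM s us); rewrite rmorph_sum /=; exact: ler_sum.
have [a ha] := real_abs_complete (bnd (fun i => complex.Re (f i)) (fun i =>
  normc_ge_Re _)).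
have [b hb] := real_abs_complete (bnd (fun i => complex.Im (f i)) (fun i =>
  normc_ge_Im _)).
exists (a +i* b) => e e0.
(* Being positive in [R[i]] includes being real. *)
have eE : e = (complex.Re e)%:C.
  by move: (ltW e0); case: (e) => x y; rewrite lecE /= => /andP[/eqP->].
have e20 : 0 < complex.Re e / 2 by rewrite divr_gt0 // -ltcR -eE.
have [A hA] := ha _ e20; have [B hB] := hb _ e20.
exists (A ++ B) => s us ABs.
have h1 : `|a - \sum_(i <- s) complex.Re (f i)| < complex.Re e / 2.
  by apply: hA => // i iA; apply: ABs; rewrite mem_cat iA.
have h2 : `|b - \sum_(i <- s) complex.Im (f i)| < complex.Re e / 2.
  by apply: hB => // i iB; apply: ABs; rewrite mem_cat iB orbT.
apply: le_lt_trans (norm_le _) _; rewrite eE ltcR [ltRHS]splitr.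
have -> : a +i* b - \sum_(i <- s) f i =
  (a - \sum_(i <- s) complex.Re (f i)) +i* (b - \sum_(i <- s) complex.Im (f i)).
  elim: s {us ABs h1 h2} => [|x s IH]; first by rewrite !big_nil !subr0.
  rewrite !big_cons opprD addrCA IH; case: (f x) => u v /=.
  by apply/eqP; rewrite eq_complex /=; apply/andP; split; apply/eqP; ring.
exact: ltrD.
Qed.
End Completeness.

(** * Infinite products *)

Section InfiniteProducts.
Variable C : numFieldType.
Hypothesis cC : abs_complete C.
Implicit Types (a p x : C).

Lemma abs_summable_nat (f : nat -> C) (M : C) :
  (forall n, \sum_(0 <= k < n) `|f k| <= M) -> abs_summable f.
Proof.
move=> fM; exists M => s us.
apply: le_trans (fM (\max_(i <- s) i).+1); apply: ler_sum_subset => // i si.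
by rewrite mem_index_iota ltnS leq_bigmax_seq.
Qed.

Lemma hassum_series (f : nat -> C) (S : C) :
  hassum f S -> \sum_(0 <= k < n) f k @[n --> \oo] --> S.
Proof.
move=> hf; apply/cvgrPdist_lt => e /hf[A hA]; near=> n; apply: hA.
  exact: iota_uniq.
move=> i iA; rewrite mem_index_iota leq0n /=.
apply: (@leq_ltn_trans (\max_(i <- A) i)); first exact: leq_bigmax_seq.
by near: n; exists (\max_(i <- A) i).+1.
Unshelve. all: by end_near.
Qed.

Lemma abs_summable_cvg0 (f : nat -> C) :
  abs_summable f -> f n @[n --> \oo] --> 0.
Proof.
move=> af; apply/cvgrPdist_lt => e e0.
have [A hA] := abs_summable_tail cC af e0; near=> n.
have := hA [:: n] isT; rewrite big_seq1 sub0r normrN; apply => i.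
rewrite inE => /eqP ->; apply/negP => nA.
have : (\max_(i <- A) i < n)%N by near: n; exists (\max_(i <- A) i).+1.
by rewrite ltnNge leq_bigmax_seq.
Unshelve. all: by end_near.
Qed.

Lemma sum_geometric_le x n : `|x| < 1 ->
  \sum_(0 <= k < n) `|x ^+ k| <= (1 - `|x|)^-1.
Proof.
move=> x1; have h : 0 < 1 - `|x| by rewrite subr_gt0.
rewrite -[leRHS]mul1r ler_pdivlMr // mulrC.
under eq_bigr do rewrite normrX.
rewrite big_mkord -opprB mulNr -subrX1 opprB gerBl exprn_ge0 //.
Qed.

(** The powers are the terms of an absolutely summable geometric series; completeness replaces an
    archimedean argument. *)
Lemma cvg_expn0 x : `|x| < 1 -> x ^+ n @[n --> \oo] --> 0.
Proof.
move=> x1; apply/abs_summable_cvg0/abs_summable_nat => n.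
exact: sum_geometric_le.
Qed.

(** The induction rests on [(1 + x) (1 - s - x) <= 1 - s] for nonnegative [s] and [x]. *)
Lemma prod_upper (c : nat -> C) n : (forall k, 0 <= c k) ->
  (\prod_(0 <= k < n) (1 + c k)) * (1 - \sum_(0 <= k < n) c k) <= 1.
Proof.
move=> c0; elim: n => [|n IH]; first by rewrite !big_geq // mul1r subr0.
rewrite !big_nat_recr //=; apply: le_trans IH; rewrite -mulrA ler_wpM2l //.
  by rewrite prodr_ge0 // => i _; rewrite addr_ge0.
set s := \sum_(0 <= k < n) c k; have s0 : 0 <= s by rewrite sumr_ge0.
have -> : (1 + c n) * (1 - (s + c n)) = 1 - s - (c n * s + c n * c n) by ring.
by rewrite gerBl addr_ge0 ?mulr_ge0.
Qed.

Lemma prod_lower (c : nat -> C) n : (forall k, 0 <= c k <= 1) ->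
  1 - \sum_(0 <= k < n) c k <= \prod_(0 <= k < n) (1 - c k).
Proof.
move=> c01; elim: n => [|n IH]; first by rewrite !big_geq // subr0.
have /andP[c0 c1] := c01 n.
rewrite !big_nat_recr //= opprD addrA.
have h : \prod_(0 <= k < n) (1 - c k) <= 1.
  rewrite prodr_ile1 // => k _; have /andP[ck0 ck1] := c01 k.
  by rewrite subr_ge0 ck1 gerBl ck0.
rewrite mulrBr mulr1 lerD // lerN2 -[leRHS]mul1r ler_wpM2r //.
Qed.

(** The norms of [a * p ^+ k] sum to at most 1/2, so the partial products stay between 1/2 and 2 in
    norm. Hence their increments are absolutely summable, and the limit of the telescoping series is
    not 0. *)
Lemma qpoch_cvg_small a p : `|p| < 1 -> `|a| / (1 - `|p|) <= 2^-1 ->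
  exists2 l, l != 0 & \prod_(0 <= k < n) (1 - a * p ^+ k) @[n --> \oo] --> l.
Proof.
move=> p1 ap; pose c k := `|a * p ^+ k|.
have sc n : \sum_(0 <= k < n) c k <= 2^-1.
  apply: le_trans ap; under eq_bigr do rewrite /c normrM.
  by rewrite -mulr_sumr ler_wpM2l // sum_geometric_le.
have half : (2^-1 : C) = 1 - 2^-1 by rewrite [X in X - _](splitr 1) mul1r addrK.
have c1 k : 0 <= c k <= 1.
  rewrite normr_ge0 /=; apply: (@le_trans _ _ 2^-1); last first.
    by rewrite invf_le1 ?ltr0n // ler1n.
  by apply: le_trans (sc k.+1);
    rewrite big_nat_recr //= lerDr sumr_ge0 // => i _; exact: normr_ge0.
pose P n := \prod_(0 <= k < n) (1 - a * p ^+ k).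
have Pu n : `|P n| <= 2.
  have h := prod_upper n (fun k => normr_ge0 (a * p ^+ k)).
  have : (\prod_(0 <= k < n) (1 + c k)) * 2^-1 <= 1.
    apply: le_trans h; rewrite ler_wpM2l //.
      by rewrite prodr_ge0 // => k _; rewrite addr_ge0 ?normr_ge0.
    by rewrite [leLHS]half lerD2l lerN2 sc.
  rewrite ler_pdivrMr ?ltr0n // mul1r; apply: le_trans.
  rewrite normr_prod; apply: ler_prod => k _; rewrite normr_ge0 /=.
  by apply: le_trans (ler_normB _ _) _; rewrite normr1.
have Pl n : 2^-1 <= `|P n|.
  apply: (@le_trans _ _ (\prod_(0 <= k < n) (1 - c k))).
    apply: le_trans (prod_lower n c1).
    by rewrite [leLHS]half lerD2l lerN2 sc.
  rewrite normr_prod; apply: ler_prod => k _.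
  have /andP[_ ck] := c1 k; rewrite subr_ge0 ck /=.
  by have := lerB_dist 1 (a * p ^+ k); rewrite normr1.
have [|S hS] := cC (f := fun n => P n.+1 - P n).
  apply: (@abs_summable_nat _ 1) => n.
  apply: (@le_trans _ _ (\sum_(0 <= k < n) 2 * c k)).
    apply: ler_sum => k _; rewrite /P big_nat_recr //= -/(P k).
    rewrite mulrBr mulr1 addrAC subrr sub0r normrN normrM.
    by rewrite ler_wpM2r.
  by rewrite -mulr_sumr mulrC -ler_pdivlMr ?ltr0n // mul1r.
have cvP : P n @[n --> \oo] --> 1 + S.
  have -> : P = (fun n => 1 + \sum_(0 <= k < n) (P k.+1 - P k)).
    apply/funext => n; rewrite telescope_sumr //.
    by rewrite [P 0%N]big_geq // addrC subrK.
  by apply: cvgD; [exact: cvg_cst | exact: hassum_series].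
exists (1 + S) => //; apply/eqP => S0; rewrite S0 in cvP.
have /cvgrPdist_lt/(_ 2^-1) := cvP; rewrite invr_gt0 ltr0n => /(_ isT) [N _ h].
by have := h N (leqnn N); rewrite sub0r normrN => /lt_le_trans/(_ (Pl N));
  rewrite ltxx.
Qed.

Lemma prod_shift a p K n :
  \prod_(0 <= k < n + K) (1 - a * p ^+ k) =
  \prod_(0 <= k < K) (1 - a * p ^+ k) *
  \prod_(0 <= k < n) (1 - a * p ^+ K * p ^+ k).
Proof.
rewrite (big_cat_nat (n := K)) ?leq_addl //=; congr (_ * _).
rewrite -{1}[K]add0n big_addn addnK; apply: eq_bigr => k _.
by rewrite exprD mulrA mulrAC.
Qed.

Lemma qpoch_tail_small a p : `|p| < 1 ->
  exists K, `|a * p ^+ K| / (1 - `|p|) <= 2^-1.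
Proof.
move=> p1; have h : 0 < 1 - `|p| by rewrite subr_gt0.
pose e := 2^-1 * (1 - `|p|) / (`|a| + 1).
have a1 : 0 < `|a| + 1 by rewrite ltr_wpDl.
have e0 : 0 < e by rewrite divr_gt0 // mulr_gt0 // invr_gt0 ltr0n.
have /cvgrPdist_lt/(_ _ e0) [N _ hN] := cvg_expn0 p1.
exists N; have := hN N (leqnn N);
  rewrite sub0r normrN ltr_pdivlMr // => /ltW hh.
rewrite ler_pdivrMr //; apply: le_trans hh; rewrite normrM mulrC ler_wpM2l //.
by rewrite lerDl.
Qed.

(** After finitely many factors the tail meets the smallness condition and has a nonzero limit, so
    the whole product can vanish only through one of its factors. *)
Lemma qpoch_cvg_neq0 a p : `|p| < 1 ->
  \prod_(0 <= k < n) (1 - a * p ^+ k) @[n --> \oo] --> qpoch a p /\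
  ((forall k, a * p ^+ k != 1) -> qpoch a p != 0).
Proof.
move=> p1; have [K hK] := qpoch_tail_small a p1.
have [l l0 hl] := qpoch_cvg_small p1 hK.
have h : \prod_(0 <= k < n) (1 - a * p ^+ k) @[n --> \oo] -->
    \prod_(0 <= k < K) (1 - a * p ^+ k) * l.
  rewrite -(cvg_shiftn K); under eq_fun do rewrite prod_shift.
  by apply: cvgM => //; exact: cvg_cst.
have -> : qpoch a p = \prod_(0 <= k < K) (1 - a * p ^+ k) * l.
  exact: cvg_lim h.
split => // ne1; rewrite mulf_neq0 // prodf_seq_neq0; apply/allP => k _ /=.
by rewrite subr_eq0 eq_sym ne1.
Qed.

Lemma qpoch_cvg a p : `|p| < 1 ->
  \prod_(0 <= k < n) (1 - a * p ^+ k) @[n --> \oo] --> qpoch a p.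
Proof. by move=> /(qpoch_cvg_neq0 a)[]. Qed.

Lemma qpoch_neq0 a p : `|p| < 1 -> `|a| < 1 -> qpoch a p != 0.
Proof.
move=> p1 a1; apply: (qpoch_cvg_neq0 a p1).2 => k;
  apply/eqP => /(congr1 Num.norm).
rewrite normrM normrX normr1 => h.
have : `|a| * `|p| ^+ k < 1.
  by apply: le_lt_trans a1; rewrite ler_piMr // exprn_ile1 // ltW.
by rewrite h ltxx.
Qed.

Lemma qpoch_eq a p l : `|p| < 1 ->
  \prod_(0 <= k < n) (1 - a * p ^+ k) @[n --> \oo] --> l -> qpoch a p = l.
Proof. by move=> p1 hl; exact: cvg_lim hl. Qed.

Lemma qpoch_recl a p : `|p| < 1 -> qpoch a p = (1 - a) * qpoch (a * p) p.
Proof.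
move=> p1; apply: qpoch_eq => //; rewrite -(cvg_shiftn 1).
under eq_fun do rewrite prod_shift.
rewrite big_nat1 expr0 mulr1 expr1.
by apply: cvgM; [exact: cvg_cst | exact: qpoch_cvg].
Qed.

Lemma qpochMN a p : `|p| < 1 ->
  qpoch a p * qpoch (- a) p = qpoch (a ^+ 2) (p ^+ 2).
Proof.
move=> p1; apply/esym/qpoch_eq; first by rewrite normrX exprn_ilt1.
apply: cvg_ext (cvgM (@qpoch_cvg a _ p1) (@qpoch_cvg (- a) _ p1)) => n.
rewrite /= -big_split /=; apply: eq_bigr => k _.
by rewrite exprAC; ring.
Qed.

Lemma prod_dissect (F : nat -> C) m n :
  \prod_(0 <= k < n * m) F k =
  \prod_(0 <= j < m) \prod_(0 <= k < n) F (k * m + j)%N.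
Proof.
elim: n => [|n IH].
  by rewrite mul0n big_geq // big1 // => j _; rewrite big_geq.
rewrite mulSnr (big_cat_nat (n := n * m)) ?leq_addr //= IH.
under [RHS]eq_bigr do rewrite big_nat_recr //=.
rewrite big_split /=; congr (_ * _).
by rewrite -{1}[(n * m)%N]add0n big_addn addKn; apply: eq_bigr => j _;
  rewrite addnC.
Qed.

(** Factors are grouped by the residue of their index modulo [m], along the subsequence of partial
    products of length [n * m]. *)
Lemma qpoch_dissect m a p : (0 < m)%N -> `|p| < 1 ->
  qpoch a p = \prod_(0 <= j < m) qpoch (a * p ^+ j) (p ^+ m).
Proof.
move=> m0 p1; have pm1 : `|p ^+ m| < 1 by rewrite normrX exprn_ilt1 -?lt0n.
have h : \prod_(0 <= k < n * m) (1 - a * p ^+ k) @[n --> \oo] -->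
    \prod_(0 <= j < m) qpoch (a * p ^+ j) (p ^+ m).
  apply: cvg_ext (fun n => esym (prod_dissect _ m n)) _.
  elim: (index_iota 0 m) => [|j s IH].
    apply: (cvg_ext (u := fun=> 1)) => [n|]; rewrite big_nil //.
    exact: cvg_cst.
  rewrite big_cons; apply: cvg_ext (fun n => esym (big_cons _ _ _ _ _ _)) _.
  apply: cvgM => //.
  apply: cvg_ext (@qpoch_cvg (a * p ^+ j) _ pm1) => n; apply: eq_bigr => k _.
  by rewrite -mulrA -exprM -exprD; congr (1 - a * p ^+ _); lia.
have hm : (n * m)%N @[n --> \oo] --> \oo.
  apply/cvgnyPge => A; near=> n; apply: (@leq_trans n).
    by near: n; exists A.
  by rewrite leq_pmulr.
have h' : \prod_(0 <= k < n * m) (1 - a * p ^+ k) @[n --> \oo] --> qpoch a p.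
  exact: (@cvg_comp _ _ _ (fun n => n * m)%N
    (fun n => \prod_(0 <= k < n) (1 - a * p ^+ k))
      _ _ _ hm (@qpoch_cvg a p p1)).
exact: (cvg_unique _ h' h).
Unshelve. all: by end_near.
Qed.
End InfiniteProducts.

(** * The Jacobi triple product *)

Section TripleProduct.
Variable C : numFieldType.
Hypothesis cC : abs_complete C.
Implicit Types (r p x y z : C).

(** The modified Jacobi theta function of nome [p], without the factor [(p; p)_oo]. *)
Definition theta p x : C := qpoch x p * qpoch (p / x) p.

(* With [p = r ^+ 2] this is [p ^ (j * (j - 1) / 2) * x ^ j]; working with a
   square root [r] of the nome avoids the division of the exponent. *)
Definition tterm r x (j : int) : C := r ^ (j * (j - 1)) * x ^ j.

(** Once the ratios are at most 1/2 in norm, the partial sum of norms plus twice the norm of the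
    next term does not increase; [B] is its value at [N]. *)
Lemma abs_summable_ratio (F c : nat -> C) :
  (forall n, F n.+1 = F n * c n) -> c n @[n --> \oo] --> 0 -> abs_summable F.
Proof.
move=> Fc c0; have h2 : (0 : C) < 2^-1 by rewrite invr_gt0 ltr0n.
have /cvgrPdist_lt/(_ _ h2) [N _ hN] := c0.
pose B := \sum_(0 <= k < N) `|F k| + 2 * `|F N|.
have key m : \sum_(0 <= k < N + m) `|F k| + 2 * `|F (N + m)%N| <= B.
  elim: m => [|m IH]; first by rewrite addn0.
  apply: le_trans IH; rewrite addnS big_nat_recr //= -addrA lerD2l Fc normrM.
  have : `|c (N + m)%N| <= 2^-1.
    by have /ltW := hN (N + m)%N (leq_addr _ _); rewrite sub0r normrN.
  set u := `|F _|; set v := `|c _| => vh.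
  rewrite [leRHS](_ : _ = u + u); last by ring.
  rewrite lerD2l mulrCA -[leRHS]mulr1 ler_wpM2l // /u //.
  by rewrite mulrC -ler_pdivlMr ?ltr0n // mul1r.
apply: (@abs_summable_nat _ _ B) => n; apply: le_trans (key n).
rewrite [leRHS](_ : _ = \sum_(0 <= k < n) `|F k| +
  (\sum_(n <= k < N + n) `|F k| + 2 * `|F (N + n)%N|)); last first.
  by rewrite addrA -big_cat_nat ?leq_addl.
rewrite lerDl.
by rewrite addr_ge0 ?sumr_ge0 // mulr_ge0 ?ler0n.
Qed.

Lemma abs_summable_int (F : int -> C) :
  abs_summable (fun n : nat => F n%:Z) ->
    abs_summable (fun n : nat => F (- n%:Z)) ->
  abs_summable F.
Proof.
move=> [M hM] [N hN]; exists (M + N) => s us.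
pose m := (\max_(i <- s) `|i|%N).+1.
apply: (@le_trans _ _ (\sum_(i <- [seq Posz n | n <- iota 0 m] ++
    [seq - Posz n | n <- iota 0 m]) `|F i|)); last first.
  by rewrite big_cat !big_map lerD // ?hM ?hN // iota_uniq.
apply: ler_sum_subset => // i si.
have im : (`|i| < m)%N by rewrite ltnS;
  exact: (@leq_bigmax_seq _ s xpredT (fun i : int => `|i|%N)).
rewrite mem_cat; apply/orP; case: (lerP 0 i) => i0; [left|right].
  by apply/mapP; exists `|i|%N; [rewrite mem_iota | lia].
by apply/mapP; exists `|i|%N; [rewrite mem_iota | lia].
Qed.

(** Ratio test in both directions: with [p = r ^+ 2], consecutive terms have ratio [p^n x] upwards
    and [p^(n+1) / x] downwards. *)
Lemma tterm_summable r x : r != 0 -> `|r| < 1 -> x != 0 ->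
  abs_summable (tterm r x).
Proof.
move=> r0 r1 x0; have p1 : `|r ^+ 2| < 1 by rewrite normrX exprn_ilt1.
have cv : (r ^+ 2) ^+ n @[n --> \oo] --> 0 by exact: cvg_expn0.
apply: abs_summable_int.
- apply: (@abs_summable_ratio _ (fun n => (r ^+ 2) ^+ n * x)) => [n|].
    rewrite /tterm (_ : n.+1%:Z * (n.+1%:Z - 1) = n%:Z * (n%:Z - 1)
      + (2 * n)%N);
      last by lia.
    rewrite expfzDr // -exprnP exprM intS (addrC 1) expfzDr // expr1z; ring.
  by rewrite -(mul0r x); apply: cvgM => //; exact: cvg_cst.
- apply: (@abs_summable_ratio _ (fun n => (r ^+ 2) ^+ n * (r ^+ 2 / x))) =>
  [n|].
    rewrite /tterm (_ : - n.+1%:Z * (- n.+1%:Z - 1) =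
      - n%:Z * (- n%:Z - 1) + (2 * n.+1)%N); last by lia.
    rewrite expfzDr // -exprnP exprM exprSr intS opprD (addrC (- 1)) expfzDr //.
    by rewrite exprN1; ring.
  by rewrite -(mul0r (r ^+ 2 / x)); apply: cvgM => //; exact: cvg_cst.
Qed.

(** The Gaussian binomial coefficient, by a q-Pascal rule free of division. When [m' < k'] the
    truncated exponent is harmless, since the coefficient it multiplies is 0. *)
Fixpoint gauss_binom p (m k : nat) : C :=
  match m, k with
  | _, 0 => 1
  | 0, _.+1 => 0
  | m'.+1, k'.+1 => gauss_binom p m' k + p ^+ (m' - k') * gauss_binom p m' k'
  end.

Lemma gauss_binom_small p m k : (m < k)%N -> gauss_binom p m k = 0.
Proof.
elim: m k => [|m IH] [|k] //=; rewrite ltnS => mk.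
by rewrite !IH ?mulr0 ?addr0 // ltnW.
Qed.

Lemma gauss_binom0 p m : gauss_binom p m 0 = 1.
Proof. by case: m. Qed.

(** The quotient formula cleared of denominators; its induction step is [1 - p^(m+1) = (1 - p^(m-k))
    + p^(m-k) (1 - p^(k+1))]. *)
Lemma gauss_binomP p m k : (k <= m)%N ->
  gauss_binom p m k * (\prod_(0 <= i < k) (1 - p * p ^+ i) *
    \prod_(0 <= i < m - k) (1 - p * p ^+ i)) = \prod_(0 <= i < m)
      (1 - p * p ^+ i).
Proof.
pose Q n := \prod_(0 <= i < n) (1 - p * p ^+ i).
have Q0 : Q 0%N = 1 by rewrite /Q big_geq.
have QS n : Q n.+1 = Q n * (1 - p * p ^+ n) by rewrite /Q big_nat_recr.
rewrite -/(Q _) -/(Q _) -/(Q _).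
elim: m k => [|m IH] [|k] //=; rewrite ?subn0 ?Q0 ?gauss_binom0 ?mul1r //.
rewrite ltnS subSS leq_eqVlt => /orP[/eqP ->|km].
  have := IH m (leqnn m); rewrite subnn Q0 mulr1 => h.
  by rewrite gauss_binom_small // add0r expr0 mul1r mulr1 !QS mulrA h.
have h1 := IH k.+1 km; have h2 := IH k (ltnW km).
have E : (m - k)%N = (m - k.+1).+1 by lia.
have e : p * p ^+ m = p ^+ (m - k) * (p * p ^+ k).
  by rewrite mulrCA -exprD subnK // ltnW.
rewrite [Q m.+1]QS e; rewrite mulrDl.
have -> : gauss_binom p m k.+1 * (Q k.+1 * Q (m - k)%N) =
    Q m * (1 - p ^+ (m - k)).
  by rewrite -h1 E [Q (m - k.+1).+1]QS exprS; ring.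
have -> : p ^+ (m - k) * gauss_binom p m k * (Q k.+1 * Q (m - k)%N) =
    p ^+ (m - k) * (1 - p * p ^+ k) * Q m.
  by rewrite -h2 QS; ring.
ring.
Qed.

(** Rothe's q-binomial theorem in base [p = r ^+ 2], by the q-Pascal rule; [r ^+ (k * k.-1)] is [p]
    to the power k choose 2. *)
Lemma gauss_binomial_theorem r z m :
  \prod_(0 <= k < m) (1 + z * (r ^+ 2) ^+ k) =
  \sum_(0 <= k < m.+1) gauss_binom (r ^+ 2) m k * (r ^+ (k * k.-1) * z ^+ k).
Proof.
elim: m => [|m IH].
  by rewrite big_geq // big_nat1 /= mul0n !expr0 !mulr1.
rewrite big_nat_recr //= IH.
pose t k := gauss_binom (r ^+ 2) m k * (r ^+ (k * k.-1) * z ^+ k).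
rewrite [RHS]big_nat_recl //= mul0n !expr0 !mulr1.
rewrite [X in _ = 1 + X](eq_big_nat _ _
    (F2 := fun k => t k.+1 + t k * (z * (r ^+ 2) ^+ m))) => [|k /andP[_ km]];
  last first.
  rewrite mulrDl -/(t k.+1); congr (_ + _).
  rewrite /t [z ^+ k.+1]exprS (_ : r ^+ (k.+1 * k) = r ^+ (k * k.-1)
    * (r ^+ 2) ^+ k).
    have -> : (r ^+ 2) ^+ m = (r ^+ 2) ^+ (m - k) * (r ^+ 2) ^+ k.
      by rewrite -exprD subnK.
    by ring.
  by rewrite -exprM -exprD; congr (r ^+ _); case: (k) => //= k'; lia.
rewrite big_split /= -mulr_suml mulrDr mulr1 addrA; congr (_ + _).
have t0 : t 0%N = 1 by rewrite /t gauss_binom0 mul0n !expr0 !mulr1.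
have tm : t m.+1 = 0 by rewrite /t gauss_binom_small ?mul0r.
rewrite -[X in X + _]t0 -big_nat_recl // [RHS]big_nat_recr //= tm addr0 //.
Qed.

Lemma prod_nat_rev (F : nat -> C) n :
  \prod_(0 <= k < n) F k = \prod_(0 <= k < n) F (n - k.+1)%N.
Proof. by rewrite big_nat_rev /= add0n. Qed.

(** The q-binomial theorem with [n + n] factors at [z = x / p ^+ n]: the last [n] factors are those
    in [x], and the first [n], reversed, are those in [p / x] up to the monomial [D]. *)
Lemma finite_triple_product r x n : r != 0 -> x != 0 ->
  \prod_(0 <= k < n) (1 + x * (r ^+ 2) ^+ k) *
  \prod_(0 <= k < n) (1 + r ^+ 2 / x * (r ^+ 2) ^+ k) =
  \sum_(0 <= k < (n + n).+1)
    gauss_binom (r ^+ 2) (n + n) k * tterm r x (k%:Z - n%:Z).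
Proof.
move=> r0 x0; set p := r ^+ 2; have p0 : p != 0 by rewrite expf_neq0.
have pn0 k : p ^+ k != 0 by rewrite expf_neq0.
pose D := \prod_(0 <= k < n) (x / p ^+ k.+1).
have DE : D = x ^+ n / r ^+ (n * n.+1).
  rewrite /D; elim: (n) => [|k IH];
    first by rewrite big_geq // expr0 mul0n expr0 divr1.
  rewrite big_nat_recr //= IH [x ^+ _.+1]exprS (_ : (k.+1 * k.+2 = k * k.+1 +
    2 * k.+1)%N); last by lia.
  by rewrite exprD [r ^+ (2 * _)]exprM -/p invfM; ring.
have D0 : D != 0 by rewrite DE mulf_neq0 ?invr_eq0 ?expf_neq0.
apply: (mulfI D0); rewrite mulrCA.
have -> : D * \prod_(0 <= k < n) (1 + p / x * p ^+ k) =
    \prod_(0 <= k < n) (1 + x / p ^+ n * p ^+ k).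
  rewrite [RHS]prod_nat_rev -big_split /=; apply: eq_big_nat => k /andP[_ kn].
  have -> : p ^+ n = p ^+ (n - k.+1) * p ^+ k.+1 by rewrite -exprD subnK.
  by rewrite exprS; field; rewrite x0 p0 !pn0.
rewrite mulrC.
have := gauss_binomial_theorem r (x / p ^+ n) (n + n).
rewrite -/p (big_cat_nat (n := n)) ?leq_addr //=.
have -> : \prod_(n <= k < n + n) (1 + x / p ^+ n * p ^+ k) =
    \prod_(0 <= k < n) (1 + x * p ^+ k).
  have := big_addn 0 (n + n) n xpredT (fun k => 1 + x / p ^+ n * p ^+ k).
  rewrite add0n addnK => ->; apply: eq_bigr => k _.
  by rewrite addnC exprD mulrA divfK.
move=> ->; rewrite mulr_sumr; apply: eq_bigr => k _.
rewrite [RHS]mulrCA; congr (_ * _); rewrite DE /tterm.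
have -> : x ^ (k%:Z - n%:Z) = x ^+ k / x ^+ n.
  by rewrite expfzDr // exprnN -!exprnP.
have -> : r ^ ((k%:Z - n%:Z) * (k%:Z - n%:Z - 1)) =
    r ^+ (k * k.-1) * r ^+ (n * n.+1) / (p ^+ n) ^+ k.
  rewrite /p -!exprM -exprD [in RHS]exprnP exprnN -expfzDr //.
  by congr (r ^ _); case: (k) => [|k'] /=; lia.
have A0 : r ^+ (n * n.+1) != 0 by rewrite expf_neq0.
have B0 : x ^+ n != 0 by rewrite expf_neq0.
have E0 : (p ^+ n) ^+ k != 0 by rewrite expf_neq0.
rewrite exprMn exprVn;
  move: (r ^+ (n * n.+1)) (x ^+ n) (_ ^+ k) (x ^+ k) A0 B0 E0.
by move: (r ^+ _) => u A B E F A0 B0 E0; field; rewrite A0 B0 E0.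
Qed.
End TripleProduct.

(** * From the triple product to the three-term relation of Weierstrass *)

Section Weierstrass.
Variable C : numFieldType.
Hypothesis cC : abs_complete C.
Implicit Types (r p x y z : C).

Lemma cvg_bound (u : nat -> C) (l : C) :
  u n @[n --> \oo] --> l -> exists2 M, 0 <= M & forall n, `|u n| <= M.
Proof.
move=> ul; have ucv : cvgn u by apply/cvg_ex; exists l.
have [M [_ hM]] := cvg_seq_bounded ucv.
have h n : `|u n| <= M + 1 by apply: hM => //; rewrite ltrDl.
by exists (M + 1) => //; apply: le_trans (h 0%N).
Qed.

(** Limit of the finite triple product: the Gaussian coefficients stay bounded and tend to the
    inverse of [(p; p)_oo], so Tannery's theorem applies. *)
Lemma triple_product r x : r != 0 -> `|r| < 1 -> x != 0 ->
  hassum (tterm r x) (qpoch (r ^+ 2) (r ^+ 2) * theta (r ^+ 2) (- x)).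
Proof.
move=> r0 r1 x0; set p := r ^+ 2.
have p1 : `|p| < 1 by rewrite normrX exprn_ilt1.
have af := tterm_summable cC r0 r1 x0.
have [S hS] := cC af.
pose L := qpoch p p; have L0 : L != 0 by exact: qpoch_neq0.
pose Q (n : nat) : C := \prod_(0 <= i < n) (1 - p * p ^+ i).
have Qcv : Q n @[n --> \oo] --> L by exact: qpoch_cvg.
have QVcv : (Q n)^-1 @[n --> \oo] --> L^-1 by exact: cvgV.
have Q0 n : Q n != 0.
  rewrite /Q prodf_seq_neq0; apply/allP => i _ /=.
  rewrite -exprS subr_eq0; apply/eqP => /(congr1 Num.norm).
  rewrite normr1 normrX => h; have : `|p| ^+ i.+1 < 1 by rewrite exprn_ilt1.
  by rewrite -h ltxx.
have [U U0 hU] := cvg_bound Qcv; have [V V0 hV] := cvg_bound QVcv.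
(* On the summation range [s n] this is the Gaussian coefficient of [n + n] over [n + j]; [absz]
   extends it to a bounded function of every integer [j], as Tannery's theorem demands. *)
pose c n (j : int) := Q (n + n)%N * (Q (absz (n%:Z + j)))^-1 * (Q (absz (n%:Z
  - j)))^-1.
pose s n := [seq k%:Z - n%:Z | k <- index_iota 0 (n + n).+1].
have sub (g : nat -> nat) (u : nat -> C) (l : C) :
    (forall A, \forall n \near \oo, (A <= g n)%N) ->
    u n @[n --> \oo] --> l -> u (g n) @[n --> \oo] --> l.
  move=> hg ul; have hg' : g n @[n --> \oo] --> \oo by apply/cvgnyPge.
  exact: (@cvg_comp _ _ _ g u _ _ _ hg' ul).
have h1 : \sum_(i <- s n) c n i * tterm r x i @[n --> \oo] --> L^-1 * S.
  apply: (hassum_tannery (K := U * V * V) cC af hS).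
  - by move=> n; rewrite map_inj_uniq ?iota_uniq // => a b /=; lia.
  - move=> i; near=> n; apply/mapP; exists (absz (i + n%:Z)).
      rewrite mem_index_iota leq0n /=.
      have : (`|i| <= n)%N by near: n; exists `|i|%N.
      lia.
    have : (`|i| <= n)%N by near: n; exists `|i|%N.
    lia.
  - by rewrite !mulr_ge0.
  - by move=> n i; rewrite !normrM !ler_pM ?mulr_ge0.
  - move=> i; have -> : L^-1 = L * L^-1 * L^-1 by rewrite divff // mul1r.
    apply: cvgM; [apply: cvgM|].
    + by apply: (sub (fun n => n + n)%N _ _ _ Qcv) => A;
      exists A => // n /= An; lia.
    + apply: (sub (fun n => absz (n%:Z + i)) (fun n => (Q n)^-1) _ _ QVcv) => A.
      by exists (A + `|i|)%N => // n /= An; lia.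
    + apply: (sub (fun n => absz (n%:Z - i)) (fun n => (Q n)^-1) _ _ QVcv) => A.
      by exists (A + `|i|)%N => // n /= An; lia.
have h2 : \sum_(i <- s n) c n i * tterm r x i @[n --> \oo] --> theta p (- x).
  apply: cvg_ext (cvgM (qpoch_cvg cC (a := - x) p1)
    (qpoch_cvg cC (a := p / - x) p1)) => n /=; rewrite /s big_map.
  under eq_bigr do rewrite mulNr opprK.
  under [X in _ * X]eq_bigr do rewrite invrN mulrN mulNr opprK.
  rewrite finite_triple_product //; apply: eq_big_nat => k /andP[_ kn].
  congr (_ * _); rewrite /c.
  rewrite ltnS in kn; have := gauss_binomP p kn;
    rewrite -/(Q _) -/(Q _) -/(Q _) => <-.
  have -> : absz (n%:Z + (k%:Z - n%:Z))%R = k by lia.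
  have -> : absz (n%:Z - (k%:Z - n%:Z))%R = (n + n - k)%N by lia.
  by field; rewrite !Q0.
suff -> : L * theta p (- x) = S by [].
by rewrite -(cvg_unique (@norm_hausdorff _ C) h1 h2) mulrA divff // mul1r.
Unshelve. all: by end_near.
Qed.

Lemma theta_period p x : `|p| < 1 -> p != 0 -> x != 0 ->
  theta p (p * x) = - (theta p x / x).
Proof.
move=> p1 p0 x0; rewrite /theta.
have -> : p / (p * x) = x^-1 by field; rewrite p0 x0.
rewrite (qpoch_recl cC x p1) (qpoch_recl cC x^-1 p1) (mulrC x p) (mulrC x^-1 p).
by field.
Qed.

(** Pairs of equal parity are the [(i + j, i - j)], pairs of opposite parity the
    [(i + j + 1, i - j)]. *)
Definition parity_map (z : int * int + int * int) : int * int :=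
  match z with
  | inl (i, j) => (i + j, i - j)
  | inr (i, j) => (i + j + 1, i - j)
  end.

Lemma parity_map_bij : bijective parity_map.
Proof.
pose g (z : int * int) : int * int + int * int :=
  let: (m, n) := z in
  if ((m + n) %% 2 == 0)%Z then inl (((m + n) %/ 2)%Z, ((m - n) %/ 2)%Z)
  else inr (((m + n - 1) %/ 2)%Z, ((m - n - 1) %/ 2)%Z).
exists g.
  move=> [[i j]|[i j]] /=.
    by case: ifP => h; [congr (inl (_, _)); lia | lia].
  by case: ifP => h; [lia | congr (inr (_, _)); lia].
by move=> [m n] /=; case: ifP => h /=; congr (_, _); lia.
Qed.

(** The variables decouple because [(i + j)^2 + (i - j)^2 = 2 i^2 + 2 j^2] has no cross term. *)
Lemma tterm_even r x y i j : r != 0 -> x != 0 -> y != 0 ->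
  tterm (r ^+ 2) (x ^+ 2) i * tterm (r ^+ 2) (r ^+ 2 * y ^+ 2) j =
  tterm r (x * y) (i + j) * tterm r (x / y) (i - j).
Proof.
move=> r0 x0 y0; rewrite /tterm !expfzMl ?exprz_inv.
transitivity (r ^ (i * (i - 1) + i * (i - 1) + (j * (j - 1) + j * (j - 1)
  + (j + j))) *
    x ^ (i + i) * y ^ (j + j));
      first by rewrite !(expfzDr _ _ r0) (expfzDr _ _ x0) (expfzDr _ _ y0);
        ring.
transitivity (r ^ ((i + j) * (i + j - 1) + (i - j) * (i - j - 1)) *
    x ^ (i + j + (i - j)) * y ^ (i + j + - (i - j))); last first.
  by rewrite [r ^ (_ * _ + _)]expfzDr // [x ^ _]expfzDr // [y ^ _]expfzDr //;
    ring.
by congr (r ^ _ * x ^ _ * y ^ _); ring.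
Qed.

Lemma tterm_odd r x y i j : r != 0 -> x != 0 -> y != 0 ->
  x * y * (tterm (r ^+ 2) (r ^+ 2 * x ^+ 2) i *
    tterm (r ^+ 2) ((r ^+ 2) ^+ 2 * y ^+ 2) j) =
  tterm r (x * y) (i + j + 1) * tterm r (x / y) (i - j).
Proof.
move=> r0 x0 y0; rewrite /tterm !expfzMl ?exprz_inv.
transitivity (r ^ (i * (i - 1) + i * (i - 1) + (i + i) +
      (j * (j - 1) + j * (j - 1) + (j + j + (j + j)))) *
    x ^ (i + i + 1) * y ^ (j + j + 1)).
  by rewrite !(expfzDr _ _ r0) !(expfzDr _ _ x0) !(expfzDr _ _ y0) !expr1z;
    ring.
transitivity (r ^ ((i + j + 1) * (i + j + 1 - 1) + (i - j) * (i - j - 1)) *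
    x ^ (i + j + 1 + (i - j)) * y ^ (i + j + 1 + - (i - j))); last first.
  by rewrite [r ^ (_ * _ + _)]expfzDr // [x ^ _]expfzDr // [y ^ _]expfzDr //;
    ring.
by congr (r ^ _ * x ^ _ * y ^ _); ring.
Qed.

(** The two triple product series are multiplied and the double sum is split by parity; each class
    factors again into two triple product series, now of nome [p ^+ 2]. *)
Lemma theta_product r x y : r != 0 -> `|r| < 1 -> x != 0 -> y != 0 ->
  let p := r ^+ 2 in
  qpoch p p ^+ 2 * (theta p (x * y) * theta p (x / y)) =
  qpoch (p ^+ 2) (p ^+ 2) ^+ 2 *
    (theta (p ^+ 2) (- x ^+ 2) * theta (p ^+ 2) (- (p * y ^+ 2)) -
     x / y * theta (p ^+ 2) (- (p * x ^+ 2)) * theta (p ^+ 2) (- y ^+ 2)).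
Proof.
move=> r0 r1 x0 y0 p.
have p0 : p != 0 by rewrite expf_neq0.
have p1 : `|p| < 1 by rewrite normrX exprn_ilt1.
(* The series at [z] sums to a theta value at [- z]; starting from [- x] produces the arguments
   [x * y] and [x / y]. *)
pose X := - x.
have X0 : X != 0 by rewrite oppr_eq0.
have H (z : C) : z != 0 -> hassum (tterm r z) (qpoch p p * theta p (- z)).
  exact: triple_product.
have H2 (z : C) : z != 0 ->
    hassum (tterm p z) (qpoch (p ^+ 2) (p ^+ 2) * theta (p ^+ 2) (- z)).
  exact: triple_product.
have sr (z : C) : z != 0 -> abs_summable (tterm r z) by exact: tterm_summable.
have sp (z : C) : z != 0 -> abs_summable (tterm p z) by exact: tterm_summable.
have Xy0 : X * y != 0 by rewrite mulf_neq0.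
have Xy'0 : X / y != 0 by rewrite mulf_neq0 ?invr_eq0.
have XX0 : X ^+ 2 != 0 by rewrite expf_neq0.
have yy0 : p * y ^+ 2 != 0 by rewrite mulf_neq0 ?expf_neq0.
have pX0 : p * X ^+ 2 != 0 by rewrite mulf_neq0.
have ppy0 : p ^+ 2 * y ^+ 2 != 0 by rewrite mulf_neq0 ?expf_neq0.
have hL := hassum_pair cC (sr _ Xy0) (sr _ Xy'0) (H _ Xy0) (H _ Xy'0).
have hE := hassum_pair cC (sp _ XX0) (sp _ yy0) (H2 _ XX0) (H2 _ yy0).
have hO := hassumZ (X * y)
  (hassum_pair cC (sp _ pX0) (sp _ ppy0) (H2 _ pX0) (H2 _ ppy0)).
have hL' := hassum_reindex parity_map_bij hL.
pose g := (fun w : int * int => tterm r (X * y) w.1 * tterm r (X / y) w.2)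
  \o parity_map.
have eE w : tterm p (X ^+ 2) w.1 * tterm p (p * y ^+ 2) w.2 = g (inl w).
  by case: w => i j; exact: tterm_even.
have eO w : X * y * (tterm p (p * X ^+ 2) w.1 * tterm p (p ^+ 2 * y ^+ 2) w.2) =
    g (inr w).
  by case: w => i j; exact: tterm_odd.
have := hassum_unique hL' (hassum_inlr (f := g) (eq_hassum eE hE)
  (eq_hassum eO hO)).
rewrite (_ : - (X * y) = x * y); last by rewrite /X; ring.
rewrite (_ : - (X / y) = x / y); last by rewrite /X; ring.
rewrite (_ : X ^+ 2 = x ^+ 2); last by rewrite /X; ring.
(* The quasi-period brings the odd class back to the argument [- y ^+ 2] and contributes the
   [1 / y^2] that turns [x * y] into [x / y]. *)
have -> : - (p ^+ 2 * y ^+ 2) = p ^+ 2 * - y ^+ 2 by ring.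
rewrite theta_period ?oppr_eq0 ?expf_neq0 ?normrX ?exprn_ilt1 //.
have -> : theta (p ^+ 2) (- y ^+ 2) / - y ^+ 2 =
   - (theta (p ^+ 2) (- y ^+ 2) / y ^+ 2) by field.
move=> K; rewrite (_ : qpoch p p ^+ 2 * _ = qpoch p p * theta p (x * y) *
  (qpoch p p * theta p (x / y))); last by ring.
by rewrite K /X; field.
Qed.

(** By [theta_product], [t (z * w) * t (z / w)] is [d * z] times the 2 by 2 minor of the columns
    [(a z, b z)] and [(a w, b w)]. The outer factors [y], [u], [u] give all three terms the same
    monomial [x y u], leaving the Pluecker relation. *)
Lemma weierstrass_relation r x y u v : r != 0 -> `|r| < 1 ->
  x != 0 -> y != 0 -> u != 0 -> v != 0 ->
  let t := theta (r ^+ 2) in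
  y * (t (x * y) * t (x / y) * (t (u * v) * t (u / v))) -
  u * (t (x * u) * t (x / u) * (t (y * v) * t (y / v))) +
  u * (t (x * v) * t (x / v) * (t (y * u) * t (y / u))) = 0.
Proof.
move=> r0 r1 x0 y0 u0 v0 t.
have p0 : r ^+ 2 != 0 by rewrite expf_neq0.
have p1 : `|r ^+ 2| < 1 by rewrite normrX exprn_ilt1.
pose c := qpoch (r ^+ 2) (r ^+ 2); have c0 : c != 0 by exact: qpoch_neq0.
pose a z := theta ((r ^+ 2) ^+ 2) (- z ^+ 2) / z.
pose b z := theta ((r ^+ 2) ^+ 2) (- (r ^+ 2 * z ^+ 2)).
pose d := qpoch ((r ^+ 2) ^+ 2) ((r ^+ 2) ^+ 2) ^+ 2 / c ^+ 2.
have E z w : z != 0 -> w != 0 -> t (z * w) * t (z / w) =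
    d * z * (a z * b w - b z * a w).
  move=> z0 w0; apply: (mulfI (expf_neq0 2 c0)); rewrite theta_product //.
  rewrite /d /a -/(b z) -/(b w) -/c.
  move: (qpoch _ _) (theta _ (- z ^+ 2)) (theta _ (- w ^+ 2)) (b z) (b w) => *.
  by field; rewrite z0 w0 c0.
rewrite (E _ _ x0 y0) (E _ _ u0 v0) (E _ _ x0 u0) (E _ _ y0 v0) (E _ _ x0 v0).
rewrite (E _ _ y0 u0);
  move: (a x) (a y) (a u) (a v) (b x) (b y) (b u) (b v) (d).
by move=> *; ring.
Qed.
End Weierstrass.

(** * Theta relations of levels 5, 10 and 20 *)

Section Levels.
Variable C : numFieldType.
Hypothesis cC : abs_complete C.
Implicit Types (p q x : C).

Definition th (n : nat) q (k : nat) : C := theta (q ^+ n) (q ^+ k).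

Lemma theta_double p x : `|p| < 1 -> p != 0 -> x != 0 ->
  theta p x = theta (p ^+ 2) x * theta (p ^+ 2) (x * p).
Proof.
move=> p1 p0 x0; rewrite /theta !(@qpoch_dissect _ cC 2 _ p)
  // !big_nat_recr //= !big_geq //.
rewrite !expr0 !expr1 !mulr1 !mul1r.
have -> : p / x * p = p ^+ 2 / x by ring.
have -> : p ^+ 2 / (x * p) = p / x by field; rewrite x0 p0.
ring.
Qed.

Lemma thetaMN p x : `|p| < 1 -> x != 0 ->
  theta p x * theta p (- x) = theta (p ^+ 2) (x ^+ 2).
Proof.
move=> p1 x0; rewrite /theta -qpochMN //.
have -> : p ^+ 2 / x ^+ 2 = (p / x) ^+ 2 by field.
rewrite -(qpochMN cC (p / x)) //; have -> : p / - x = - (p / x) by field.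
ring.
Qed.

Variable q : C.
Hypotheses (q0 : q != 0) (q1 : `|q| < 1).

Lemma q_exp_lt1 n : (0 < n)%N -> `|q ^+ n| < 1.
Proof. by move=> n0; rewrite normrX exprn_ilt1 // -lt0n. Qed.

Lemma q_expB i j : (j <= i)%N -> q ^+ i / q ^+ j = q ^+ (i - j).
Proof. by move=> ji; rewrite -{1}(subnK ji) exprD mulfK // expf_neq0. Qed.

Lemma th_neq0 n k : (0 < k < n)%N -> th n q k != 0.
Proof.
move=> /andP[k0 kn]; rewrite /th /theta q_expB ?(ltnW kn) //.
by rewrite mulf_neq0 ?qpoch_neq0 ?q_exp_lt1 ?subn_gt0 // (ltn_trans k0).
Qed.

Lemma th_sym n k : (k <= n)%N -> th n q (n - k) = th n q k.
Proof.
move=> kn; rewrite /th /theta !q_expB ?leq_subr // subKn //.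
exact: mulrC.
Qed.

Lemma th_double n k : (0 < n)%N ->
  th n q k = th (n * 2) q k * th (n * 2) q (k + n).
Proof.
move=> n0; rewrite /th theta_double ?expf_neq0 ?q_exp_lt1 //.
by rewrite -exprM -exprD.
Qed.

(** An even level gives the nome the square root [q ^+ m]; the ordering of the indices keeps the
    exponents natural. *)
Lemma th_relation m i j k l : (0 < m)%N -> (j <= i)%N -> (k <= j)%N ->
  (l <= k)%N ->
  let t := th (m * 2) q in
  q ^+ j * (t (i + j)%N * t (i - j)%N * (t (k + l)%N * t (k - l)%N)) -
  q ^+ k * (t (i + k)%N * t (i - k)%N * (t (j + l)%N * t (j - l)%N)) +
  q ^+ k * (t (i + l)%N * t (i - l)%N * (t (j + k)%N * t (j - k)%N)) = 0.
Proof.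
move=> m0 ji kj lk t.
have qn n : q ^+ n != 0 by rewrite expf_neq0.
have := weierstrass_relation cC (qn m) (q_exp_lt1 m0) (qn i) (qn j) (qn k)
  (qn l).
have ki := leq_trans kj ji; have lj := leq_trans lk kj;
  have li := leq_trans lk ki.
by rewrite /= -exprM -!exprD !q_expB.
Qed.

Lemma th10_sym : [/\ th 10 q 6 = th 10 q 4, th 10 q 7 = th 10 q 3,
  th 10 q 8 = th 10 q 2 & th 10 q 9 = th 10 q 1].
Proof. by split; [apply: (@th_sym 10 4)|apply: (@th_sym 10 3)|apply: (@th_sym
  10 2)|apply: (@th_sym 10 1)]. Qed.

(** Weierstrass at the exponents (5,4,3,1), (5,3,2,1) and (5,4,3,0), folded by the symmetry
    [k -> 10 - k] and divided by a power of [q]. *)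
Lemma th10_relations :
  [/\ q * (th 10 q 1 ^+ 2 * th 10 q 4 * th 10 q 2) -
        th 10 q 2 ^+ 2 * th 10 q 5 * th 10 q 3 +
        th 10 q 4 ^+ 2 * th 10 q 3 * th 10 q 1 = 0,
      q * (th 10 q 2 ^+ 2 * th 10 q 3 * th 10 q 1) -
        th 10 q 3 ^+ 2 * th 10 q 4 * th 10 q 2 +
        th 10 q 4 ^+ 2 * th 10 q 5 * th 10 q 1 = 0 &
      q * (th 10 q 1 ^+ 2 * th 10 q 3 ^+ 2) -
        th 10 q 2 ^+ 2 * th 10 q 4 ^+ 2 +
        th 10 q 5 ^+ 2 * th 10 q 3 * th 10 q 1 = 0].
Proof.
have [e6 e7 e8 e9] := th10_sym.
have h1 := @th_relation 5 5 4 3 1 isT isT isT isT.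
have h2 := @th_relation 5 5 3 2 1 isT isT isT isT.
have h3 := @th_relation 5 5 4 3 0 isT isT isT isT.
rewrite /= ?addn0 ?subn0 /= ?e6 ?e7 ?e8 ?e9 in h1 h2 h3.
have q3 : q ^+ 3 != 0 by rewrite expf_neq0.
have q2 : q ^+ 2 != 0 by rewrite expf_neq0.
split; [apply: (mulfI q3)|apply: (mulfI q2)|apply: (mulfI q3)]; rewrite mulr0.
- by rewrite -[RHS]h1; ring.
- by rewrite -[RHS]h2; ring.
- by rewrite -[RHS]h3; ring.
Qed.

(** * The continued fraction as a theta quotient, and its modular equation of degree 2 *)

Lemma RR_theta p : p != 0 -> RR p = theta (p ^+ 5) p / theta (p ^+ 5) (p ^+ 2).
Proof.
move=> p0; rewrite /RR /qpochs /theta !big_cons !big_nil !mulr1.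
have -> : p ^+ 5 / p = p ^+ 4 by field.
by have -> : p ^+ 5 / p ^+ 2 = p ^+ 3 by field.
Qed.

Lemma th5_10 : th 5 q 1 = th 10 q 1 * th 10 q 4 /\ th 5 q 2 = th 10 q 2 * th
  10 q 3.
Proof.
have [e6 e7 _ _] := th10_sym.
by split; rewrite (@th_double 5) // ?e6 ?e7.
Qed.

Lemma RR_th10 : RR q = th 10 q 1 * th 10 q 4 / (th 10 q 2 * th 10 q 3) /\
  RR (q ^+ 2) = th 10 q 2 / th 10 q 4.
Proof.
have [e1 e2] := th5_10.
split; first by rewrite RR_theta // -[X in theta _ X / _]expr1 -/(th 5 q 1)
  -/(th 5 q 2) e1 e2.
by rewrite RR_theta ?expf_neq0 // -!exprM.
Qed.

(** Equivalent to the classical [b - a^2 = q a b^2 (b + a^2)]. *)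
Lemma RR_modular2 (a := RR q) (b := RR (q ^+ 2)) (k := q * a * b ^+ 2) :
  b * (1 - k) = a ^+ 2 * (1 + k).
Proof.
have [aE bE] := RR_th10; have [h1 h2 _] := th10_relations.
have n1 := @th_neq0 10 1 isT; have n2 := @th_neq0 10 2 isT.
have n3 := @th_neq0 10 3 isT; have n4 := @th_neq0 10 4 isT.
rewrite /k /b /a aE bE.
move: (th 10 q 1) (th 10 q 2) (th 10 q 3) (th 10 q 4) (th 10 q 5)
  n1 n2 n3 n4 h1 h2 => X Y Z W V X0 Y0 Z0 W0 h1 h2.
apply/eqP; rewrite -subr_eq0; apply/eqP.
(* The difference of the two sides is a combination of the first two level 10 relations, with
   coefficients [Y ^+ 2] and [X * W ^+ 2 / Z] up to a common factor. *)
have -> : Y / W * (1 - q * (X * W / (Y * Z)) * (Y / W) ^+ 2) -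
   (X * W / (Y * Z)) ^+ 2 * (1 + q * (X * W / (Y * Z)) * (Y / W) ^+ 2) =
   - (Y ^+ 2 * (q * (Y ^+ 2 * Z * X) - Z ^+ 2 * W * Y + W ^+ 2 * V * X) +
    X * W ^+ 2 / Z * (q * (X ^+ 2 * W * Y) - Y ^+ 2 * V * Z + W ^+ 2 * Z * X)) /
   (Y ^+ 2 * Z ^+ 2 * W ^+ 2).
  by field; rewrite ?Y0 ?Z0 ?W0.
by rewrite h1 h2 !mulr0 addr0 oppr0 mul0r.
Qed.

(** Euler's identity: multiplied by [(p; p)_oo], it becomes the splitting of that product into odd
    and even powers of [p]. *)
Lemma euler_qpoch p : `|p| < 1 -> p != 0 ->
  qpoch (- p) p * qpoch p (p ^+ 2) = 1.
Proof.
move=> p1 p0; have p2 : `|p ^+ 2| < 1 by rewrite normrX exprn_ilt1.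
apply: (mulfI (qpoch_neq0 cC p1 p1)); rewrite mulr1 mulrA qpochMN //.
rewrite [RHS](@qpoch_dissect _ cC 2)
  // !big_nat_recr //= big_geq // expr0 expr1.
by rewrite mul1r mulr1 -expr2 mulrC.
Qed.

Lemma theta_N1 p : `|p| < 1 -> p != 0 -> theta p (- 1) * theta (p ^+ 2) p = 2.
Proof.
move=> p1 p0; rewrite /theta.
have -> : p / - 1 = - p by field.
have -> : p ^+ 2 / p = p by field.
rewrite (qpoch_recl cC (- 1)) // mulN1r opprK.
have -> : (1 + 1) * qpoch (- p) p * qpoch (- p) p *
   (qpoch p (p ^+ 2) * qpoch p (p ^+ 2)) =
   2 * (qpoch (- p) p * qpoch p (p ^+ 2)) ^+ 2 by ring.
by rewrite euler_qpoch // expr1n mulr1.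
Qed.

(** Weierstrass in nome [q ^+ 5] at [(q^2, -q^2, q, -q)]. This nome is an odd power of [q], so its
    square root is built from [s]. The identity later accounts for the factor [1 - 4k - k^2]. *)
Lemma th10_phi (s : C) : s ^+ 2 = q ->
  (th 10 q 1 * th 10 q 2 * th 10 q 3 * th 10 q 4) ^+ 2 =
  (th 10 q 1 * th 10 q 3)
    ^- 2 - 4 * q / (th 10 q 1 * th 10 q 3 * th 10 q 5 ^+ 2).
Proof.
move=> sq; pose r := s ^+ 5.
have rE : r ^+ 2 = q ^+ 5 by rewrite /r exprAC sq.
have s0 : s != 0 by apply: contraNneq q0 => s0; rewrite -sq s0 expr0n.
have s1 : `|s| < 1.
  by rewrite -(@expr_lt1 _ 2) // -normrX sq.
have r0 : r != 0 by rewrite expf_neq0.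
have r1 : `|r| < 1 by rewrite normrX exprn_ilt1.
have q2 : q ^+ 2 != 0 by rewrite expf_neq0.
have := weierstrass_relation cC r0 r1 q2 (y := - q ^+ 2) (u := q) (v := - q).
rewrite !oppr_eq0 => /(_ q2 q0 q0) /=; rewrite rE.
pose t := theta (q ^+ 5); rewrite -/t.
have -> : q ^+ 2 * - q ^+ 2 = - q ^+ 4 by ring.
have -> : q ^+ 2 / - q ^+ 2 = - 1 by field.
have -> : q * - q = - q ^+ 2 by ring.
have -> : q / - q = - 1 by field.
have -> : q ^+ 2 * q = q ^+ 3 by ring.
have -> : q ^+ 2 / q = q ^+ 1 by field.
have -> : - q ^+ 2 * - q = q ^+ 3 by ring.
have -> : - q ^+ 2 / - q = q ^+ 1 by field.
have -> : q ^+ 2 * - q = - q ^+ 3 by ring.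
have -> : q ^+ 2 / - q = - q ^+ 1 by field.
have -> : - q ^+ 2 * q = - q ^+ 3 by ring.
have -> : - q ^+ 2 / q = - q ^+ 1 by field.
have tN x : x != 0 -> t (- (q ^+ 5 / x)) = t (- x).
  move=> x0; rewrite /t /theta.
  have -> : q ^+ 5 / - (q ^+ 5 / x) = - x by field; rewrite x0 q0.
  have -> : q ^+ 5 / - x = - (q ^+ 5 / x) by field.
  exact: mulrC.
have -> : t (- q ^+ 4) = t (- q ^+ 1).
  by rewrite -tN ?expf_neq0 // q_expB.
have -> : t (- q ^+ 3) = t (- q ^+ 2).
  by rewrite -tN ?expf_neq0 // q_expB.
have -> : t (q ^+ 3) = t (q ^+ 2) by exact: (@th_sym 5 2).
have [e1 e2] := th5_10.
have q5 := @q_exp_lt1 5 isT.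
(* Theta values at negative arguments are traded for level 10 products, through [theta(x) theta(-x)]
   and, at [- 1], through Euler's identity. *)
have m1 : t (q ^+ 1) * t (- q ^+ 1) = th 10 q 2.
  by rewrite /t thetaMN ?expf_neq0 // -!exprM.
have m2 : t (q ^+ 2) * t (- q ^+ 2) = th 10 q 4.
  by rewrite /t thetaMN ?expf_neq0 // -!exprM.
have m0 : t (- 1) * th 10 q 5 = 2.
  by rewrite /t /th -[10%N]/(5 * 2)%N exprM theta_N1 ?expf_neq0.
have n1 := @th_neq0 10 1 isT; have n2 := @th_neq0 10 2 isT.
have n3 := @th_neq0 10 3 isT; have n4 := @th_neq0 10 4 isT.
have n5 := @th_neq0 10 5 isT.
rewrite -/(t (q ^+ 1)) in e1;
  rewrite /th -/(t (q ^+ 2)) -/(t (q ^+ 1)) in e1 e2.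
rewrite -!/(th 10 q _) in e1 e2.
rewrite e1 e2 in m1 m2 *.
move: (th 10 q 1) (th 10 q 2) (th 10 q 3) (th 10 q 4) (th 10 q 5)
  n1 n2 n3 n4 n5 m0 m1 m2 => X Y Z W V X0 Y0 Z0 W0 V0 m0 m1 m2.
have -> : t (- 1) = 2 / V by rewrite -m0 mulfK.
have -> : t (- q ^+ 1) = Y / (X * W).
  by rewrite -m1 mulrC mulKf // mulf_neq0.
have -> : t (- q ^+ 2) = W / (Y * Z).
  by rewrite -m2 mulrC mulKf // mulf_neq0.
move=> h; apply/eqP; rewrite -subr_eq0; apply/eqP.
rewrite -[RHS](mulr0 (- q^-1)) -[X in _ = _ * X]h.
by field; rewrite q0 X0 Y0 Z0 W0 V0.
Qed.
End Levels.

(** * Elimination, the eta quotient in terms of [k], and the level 20 relation *)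

Section RogersRamanujan.
Variable C : numFieldType.

(* The parametrisation [b = a^2 (1+k)/(1-k)], [c = b^2 (1+m)/(1-m)],
   [q = k/(a^5 ((1+k)/(1-k))^2)] turns [P / a^4] into a rational function of
   [k] and [m]; the difference of the two sides is then a multiple of
   [(k + m)^2 - m (1 - k^2)], with the cofactor found by polynomial division. *)
Lemma P_algebra (q a b c : C) (k := q * a * b ^+ 2) (m := q ^+ 2 * b * c ^+ 2) :
  q != 0 -> a != 0 -> b != 0 -> c != 0 ->
  b * (1 - k) = a ^+ 2 * (1 + k) -> c * (1 - m) = b ^+ 2 * (1 + m) ->
  (k + m) ^+ 2 = m * (1 - k ^+ 2) ->
  q ^+ 2 * ((1 - 4 * k - k ^+ 2) ^+ 2 * (1 + k - k ^+ 2) /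
    (k * (1 - k ^+ 2) ^+ 2)) =
  P q a b c / (a ^+ 4 * b * c ^+ 2).
Proof.
move=> q0 a0 b0 c0 hb hc hkm.
(* At [v = 1] the relation would read [0 = 2 w]. *)
have key (u v w : C) : w != 0 -> u * (1 - v) = w * (1 + v) -> 1 - v != 0.
  move=> w0 h; apply/eqP => v1; move: h; rewrite v1 mulr0 => /esym/eqP.
  have -> : v = 1 by apply/eqP; rewrite eq_sym -subr_eq0 v1.
  by rewrite mulf_eq0 (negPf w0) -(natrD _ 1 1) pnatr_eq0.
have key' (u v w : C) : u != 0 -> u * (1 - v) = w * (1 + v) -> 1 + v != 0.
  move=> u0 h; apply/eqP => v1; move: h; rewrite v1 mulr0 => /eqP.
  have -> : v = -1 by apply/eqP; rewrite -addr_eq0 addrC v1.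
  by rewrite mulf_eq0 (negPf u0) opprK -(natrD _ 1 1) pnatr_eq0.
have km0 : 1 - k != 0 by apply: key hb; rewrite expf_neq0.
have kp0 : 1 + k != 0 by apply: key' hb.
have mm0 : 1 - m != 0 by apply: key hc; rewrite expf_neq0.
have mp0 : 1 + m != 0 by apply: key' hc.
have k0 : k != 0 by rewrite !mulf_neq0 ?expf_neq0.
have bE : b = a ^+ 2 * ((1 + k) / (1 - k)).
  by rewrite mulrA -hb mulfK.
have cE : c = a ^+ 4 * ((1 + k) / (1 - k)) ^+ 2 * ((1 + m) / (1 - m)).
  by apply: (mulIf mm0); rewrite hc bE; field; rewrite ?km0 ?mm0.
have qE : q = k / (a ^+ 5 * ((1 + k) / (1 - k)) ^+ 2).
  have kE : q * (a ^+ 5 * ((1 + k) / (1 - k)) ^+ 2) = k.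
    by rewrite -[RHS]/(q * a * b ^+ 2) [b in RHS]bE; ring.
  by rewrite -[X in X / _]kE mulfK // !(mulf_neq0, expf_neq0, invr_neq0).
have dE : q ^+ 2 * (a ^+ 4 * b * c ^+ 2) = a ^+ 4 * m by rewrite /m; ring.
have d0 : a ^+ 4 * b * c ^+ 2 != 0 by rewrite !mulf_neq0 ?expf_neq0.
apply: (mulIf d0); rewrite divfK // mulrAC dE.
clear d0 dE hb hc.
move: (k) (m) km0 kp0 mm0 mp0 k0 hkm bE cE qE => {}k {}m km0 kp0 mm0 mp0 k0 hkm.
move=> -> -> ->.
pose Kp := 1 + k; pose Km := 1 - k; pose Mp := 1 + m; pose Mm := 1 - m.
rewrite -/Kp -/Km -/Mp -/Mm in km0 kp0 mm0 mp0 *.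
(* Numerator of [P / a^4] after the substitution, over the common denominator
   [Kp * Km ^+ 3 * Mm ^+ 4]. *)
pose N :=
    - 2 * k ^+ 4 * Kp * Km ^+ 3 * Mp ^+ 3 * Mm
    + k ^+ 4 * Kp * Km ^+ 3 * Mp ^+ 4
    - 2 * k ^+ 4 * Kp ^+ 2 * Km ^+ 2 * Mp ^+ 4
    - 5 * k ^+ 4 * Kp ^+ 3 * Km * Mp ^+ 4
    - k ^+ 3 * Kp * Km ^+ 3 * Mp ^+ 2 * Mm ^+ 2
    - 2 * k ^+ 3 * Kp * Km ^+ 3 * Mp ^+ 3 * Mm
    + 6 * k ^+ 3 * Kp ^+ 2 * Km ^+ 2 * Mp ^+ 3 * Mm
    - 6 * k ^+ 3 * Kp ^+ 3 * Km * Mp ^+ 3 * Mm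
    + 3 * k ^+ 3 * Kp ^+ 3 * Km * Mp ^+ 4 - k ^+ 3 * Kp ^+ 4 * Mp ^+ 4
    + 2 * k ^+ 2 * Km ^+ 4 * Mp * Mm ^+ 3
    + 4 * k ^+ 2 * Kp * Km ^+ 3 * Mp * Mm ^+ 3
    - 2 * k ^+ 2 * Kp * Km ^+ 3 * Mp ^+ 2 * Mm ^+ 2
    + 5 * k ^+ 2 * Kp ^+ 2 * Km ^+ 2 * Mp ^+ 2 * Mm ^+ 2
    + 2 * k ^+ 2 * Kp ^+ 3 * Km * Mp ^+ 2 * Mm ^+ 2
    + 4 * k ^+ 2 * Kp ^+ 3 * Km * Mp ^+ 3 * Mm
    - 2 * k ^+ 2 * Kp ^+ 4 * Mp ^+ 3 * Mm + k * Km ^+ 4 * Mm ^+ 4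
    + 3 * k * Kp * Km ^+ 3 * Mm ^+ 4 + 6 * k * Kp * Km ^+ 3 * Mp * Mm ^+ 3
    + 6 * k * Kp ^+ 2 * Km ^+ 2 * Mp * Mm ^+ 3
    + 2 * k * Kp ^+ 3 * Km * Mp * Mm ^+ 3
    - k * Kp ^+ 3 * Km * Mp ^+ 2 * Mm ^+ 2 + 5 * Kp * Km ^+ 3 * Mm ^+ 4
    - 2 * Kp ^+ 2 * Km ^+ 2 * Mm ^+ 4 - Kp ^+ 3 * Km * Mm ^+ 4
    - 2 * Kp ^+ 3 * Km * Mp * Mm ^+ 3.
have -> : P (k / (a ^+ 5 * (Kp / Km) ^+ 2)) a (a ^+ 2 * (Kp / Km))
    (a ^+ 4 * (Kp / Km) ^+ 2 * (Mp / Mm)) =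
    a ^+ 4 * N / (Kp * Km ^+ 3 * Mm ^+ 4).
  rewrite /P /N; move: (Kp) (Km) (Mp) (Mm) km0 kp0 mm0 => A B D E B0 A0 E0.
  by field; rewrite a0 A0 B0 E0.
have hN : N * (k * (Kp * Km) ^+ 2) -
    m * (1 - 4 * k - k ^+ 2) ^+ 2 * (1 + k - k ^+ 2)
      * (Kp * Km ^+ 3 * Mm ^+ 4) =
   ((k + m) ^+ 2 - m * (1 - k ^+ 2)) * (
    1 - 3 * m + 3 * m ^+ 2 - m ^+ 3 - 3 * k + 15 * k * m - 21 * k * m ^+ 2
    + 9 * k * m ^+ 3 - k ^+ 2 - k ^+ 2 * m + 21 * k ^+ 2 * m ^+ 2
    - 19 * k ^+ 2 * m ^+ 3 - 8 * k ^+ 3 - 38 * k ^+ 3 * m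
    + 84 * k ^+ 3 * m ^+ 2 - 22 * k ^+ 3 * m ^+ 3 - 54 * k ^+ 4
    + 12 * k ^+ 4 * m - 86 * k ^+ 4 * m ^+ 2 + 80 * k ^+ 4 * m ^+ 3
    + 22 * k ^+ 5 - 48 * k ^+ 5 * m - 82 * k ^+ 5 * m ^+ 2
    - 20 * k ^+ 5 * m ^+ 3 + 126 * k ^+ 6 + 48 * k ^+ 6 * m
    + 38 * k ^+ 6 * m ^+ 2 - 68 * k ^+ 6 * m ^+ 3 - 4 * k ^+ 7
    + 126 * k ^+ 7 * m + 64 * k ^+ 7 * m ^+ 2 + 38 * k ^+ 7 * m ^+ 3
    - 91 * k ^+ 8 - 81 * k ^+ 8 * m + 19 * k ^+ 8 * m ^+ 2
    + 9 * k ^+ 8 * m ^+ 3 - 11 * k ^+ 9 - 63 * k ^+ 9 * m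
    - 49 * k ^+ 9 * m ^+ 2 - 5 * k ^+ 9 * m ^+ 3 + 19 * k ^+ 10
    + 25 * k ^+ 10 * m + 5 * k ^+ 10 * m ^+ 2 - k ^+ 10 * m ^+ 3 + 4 * k ^+ 11
    + 8 * k ^+ 11 * m + 4 * k ^+ 11 * m ^+ 2).
  by rewrite /N /Kp /Km /Mp /Mm; ring.
have {}hN : N = m * (1 - 4 * k - k ^+ 2) ^+ 2 * (1 + k - k ^+ 2) *
    (Kp * Km ^+ 3 * Mm ^+ 4) / (k * (Kp * Km) ^+ 2).
  move/eqP: hN; rewrite hkm subrr mul0r subr_eq0 => /eqP <-.
  by rewrite mulfK // !mulf_neq0 ?expf_neq0 ?mulf_neq0.
rewrite hN; have -> : 1 - k ^+ 2 = Kp * Km by rewrite /Kp /Km; ring.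
rewrite -/Kp; move: (Kp) (Km) (Mm) km0 kp0 mm0 => A B E B0 A0 E0.
by field; rewrite k0 A0 B0 E0.
Qed.

Hypothesis cC : abs_complete C.
Variables (q s : C).
Hypotheses (sq : s ^+ 2 = q) (q0 : q != 0) (q1 : `|q| < 1).

Lemma RR_neq0 (p : C) : p != 0 -> `|p| < 1 -> RR p != 0.
Proof.
move=> p0 p1; rewrite /RR /qpochs !big_cons !big_nil !mulr1.
have h n : (0 < n)%N -> `|p ^+ n| < 1.
  by move=> n0; rewrite normrX exprn_ilt1 // -lt0n.
by rewrite mulf_neq0 ?invr_eq0 ?mulf_neq0 ?qpoch_neq0 ?h.
Qed.

(** The first level 10 relation turns [1 + k] into a single product, the second does the same for
    [1 - k]. *)
Lemma RR_param_th10 (k := q * RR q * RR (q ^+ 2) ^+ 2) :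
  k = q * (th 10 q 1 * th 10 q 2) / (th 10 q 3 * th 10 q 4) /\
  1 - k ^+ 2 = th 10 q 2 * th 10 q 5 ^+ 2 / (th 10 q 3 ^+ 2 * th 10 q 4).
Proof.
rewrite /k; have [-> ->] := RR_th10 cC q0 q1.
have [h1 h2 _] := th10_relations cC q0 q1.
have n1 := th_neq0 cC q0 q1 (n := 10) (k := 1) isT.
have n2 := th_neq0 cC q0 q1 (n := 10) (k := 2) isT.
have n3 := th_neq0 cC q0 q1 (n := 10) (k := 3) isT.
have n4 := th_neq0 cC q0 q1 (n := 10) (k := 4) isT.
move: (th 10 q 1) (th 10 q 2) (th 10 q 3) (th 10 q 4) (th 10 q 5)
  n1 n2 n3 n4 h1 h2 => X Y Z W V X0 Y0 Z0 W0 h1 h2.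
have -> : q * (X * W / (Y * Z)) * (Y / W) ^+ 2 = q * (X * Y) / (Z * W).
  by field; rewrite Y0 Z0 W0.
split=> //; set K := q * (X * Y) / (Z * W).
have -> : 1 - K ^+ 2 = (1 - K) * (1 + K) by ring.
have -> : 1 + K = Y ^+ 2 * V / (X * W ^+ 2).
  apply/eqP; rewrite -subr_eq0; apply/eqP.
  rewrite -[RHS](mulr0 (X * Z * W ^+ 2)^-1) -[X in _ = _ * X]h1 /K.
  by field; rewrite X0 Z0 W0.
have -> : 1 - K = X * W * V / (Y * Z ^+ 2).
  apply/eqP; rewrite -subr_eq0; apply/eqP.
  rewrite -[RHS](mulr0 (- (Y * Z ^+ 2 * W)^-1)) -[X in _ = _ * X]h2 /K.
  by field; rewrite Y0 Z0 W0.
by field; rewrite X0 Y0 Z0 W0.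
Qed.

(** Dissection modulo 5 makes the left side the sixth power of [X Y Z W], the level 10 products of
    index 1 to 4. Of this, [(X Y Z W)^4] comes from [th10_phi] and gives [(1 - 4k - k^2)^2], while
    [Y^2 W^2] comes from the third level 10 relation and gives [1 + k - k^2]. *)
Lemma eta_quotient (k := q * RR q * RR (q ^+ 2) ^+ 2) :
  qpoch q q ^+ 6 / qpoch (q ^+ 5) (q ^+ 5) ^+ 6 =
  q * ((1 - 4 * k - k ^+ 2) ^+ 2 * (1 + k - k ^+ 2) / (k * (1 - k ^+ 2) ^+ 2)).
Proof.
have q5 := q_exp_lt1 q1 (n := 5) isT.
have n0 := qpoch_neq0 cC q5 q5.
have -> : qpoch q q = th 5 q 1 * th 5 q 2 * qpoch (q ^+ 5) (q ^+ 5).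
  rewrite (@qpoch_dissect _ cC 5) // !big_nat_recr //= big_geq // /th /theta.
  by rewrite !q_expB // -!exprS mul1r; ring.
rewrite exprMn mulfK ?expf_neq0 //.
have [-> ->] := th5_10 cC q0 q1.
have [kE k2E] := RR_param_th10; rewrite -/k in kE k2E.
have [_ _ h3] := th10_relations cC q0 q1.
have h4 := th10_phi cC q0 q1 sq.
have n1 := th_neq0 cC q0 q1 (n := 10) (k := 1) isT.
have n2 := th_neq0 cC q0 q1 (n := 10) (k := 2) isT.
have n3 := th_neq0 cC q0 q1 (n := 10) (k := 3) isT.
have n4 := th_neq0 cC q0 q1 (n := 10) (k := 4) isT.
have n5 := th_neq0 cC q0 q1 (n := 10) (k := 5) isT.
move: (th 10 q 1) (th 10 q 2) (th 10 q 3) (th 10 q 4) (th 10 q 5)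
  n1 n2 n3 n4 n5 h3 h4 kE k2E => X Y Z W V X0 Y0 Z0 W0 V0 h3 h4 kE k2E.
have h3' : Y ^+ 2 * W ^+ 2 = q * (X ^+ 2 * Z ^+ 2) + V ^+ 2 * Z * X.
  by apply/eqP; rewrite -subr_eq0; apply/eqP; rewrite -[RHS]oppr0 -[in RHS]h3;
    ring.
have -> : (X * W * (Y * Z)) ^+ 6 =
    ((X * Y * Z * W) ^+ 2) ^+ 2 * (X ^+ 2 * Z ^+ 2) * (Y ^+ 2 * W ^+ 2) by ring.
rewrite h4 h3'.
have -> : 1 - 4 * k - k ^+ 2 = (1 - k ^+ 2) - 4 * k by ring.
have -> : 1 + k - k ^+ 2 = (1 - k ^+ 2) + k by ring.
by rewrite k2E kE; field; rewrite q0 X0 Y0 Z0 W0 V0.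
Qed.

(** At level 20 both [m] and [1 - k^2] are single products, and Weierstrass at the exponents
    (8,5,4,0) makes [k + m] one as well; the factors then match. *)
Lemma RR_level20 (k := q * RR q * RR (q ^+ 2) ^+ 2)
    (m := q ^+ 2 * RR (q ^+ 2) * RR (q ^+ 4) ^+ 2) :
  (k + m) ^+ 2 = m * (1 - k ^+ 2).
Proof.
have sym i : (i <= 20)%N -> th 20 q (20 - i) = th 20 q i by exact: th_sym.
have dbl i : th 10 q i = th 20 q i * th 20 q (i + 10).
  exact: (th_double cC q0 q1 (n := 10)).
have nz i : (0 < i < 20)%N -> th 20 q i != 0 by exact: th_neq0.
have q20 : q ^+ 2 != 0 by rewrite expf_neq0.
have q21 : `|q ^+ 2| < 1 by rewrite normrX exprn_ilt1.
have [bE cE] := RR_th10 cC q20 q21; rewrite -exprM in cE.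
have thq i : th 10 (q ^+ 2) i = th 20 q (2 * i) by rewrite /th -!exprM.
have mE : m = q ^+ 2 * th 20 q 2 * th 20 q 4 / (th 20 q 6 * th 20 q 8).
  rewrite /m cE bE !thq.
  by field; rewrite !nz.
have [kE k2E] := RR_param_th10; rewrite -/k in kE k2E.
have h5 : q * (th 20 q 7 * th 20 q 3 * th 20 q 4 ^+ 2) +
    th 20 q 8 ^+ 2 * th 20 q 9 * th 20 q 1 =
    th 20 q 8 * th 20 q 4 * th 20 q 5 ^+ 2.
  have := th_relation cC q0 q1 (m := 10) (i := 8) (j := 5) (k := 4) (l := 0)
    isT isT isT isT.
  rewrite /= (sym 7%N isT) (sym 8%N isT) ?addn0 ?subn0 => h.
  apply: (mulfI (expf_neq0 4 q0)); apply/eqP; rewrite -subr_eq0; apply/eqP.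
  by rewrite -[RHS]h; ring.
rewrite !dbl /= (sym 9%N isT) (sym 8%N isT) (sym 7%N isT) (sym 6%N isT) in kE.
rewrite !dbl /= (sym 8%N isT) (sym 7%N isT) (sym 6%N isT) (sym 5%N isT) in k2E.
have n2 := nz 2%N isT; have n3 := nz 3%N isT; have n4 := nz 4%N isT.
have n6 := nz 6%N isT; have n7 := nz 7%N isT; have n8 := nz 8%N isT.
have -> : k + m = q * th 20 q 2 *
    (q * (th 20 q 7 * th 20 q 3 * th 20 q 4 ^+ 2) +
     th 20 q 8 ^+ 2 * th 20 q 9 * th 20 q 1) /
    (th 20 q 6 * th 20 q 3 * th 20 q 7 * th 20 q 4 * th 20 q 8).
  by rewrite kE mE; field; rewrite n3 n4 n6 n7 n8.
by rewrite h5 k2E mE; field; rewrite n3 n4 n6 n7 n8.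
Qed.

Lemma eta_quotient_RR :
  q * (qpoch q q ^+ 6 / qpoch (q ^+ 5) (q ^+ 5) ^+ 6) =
  P q (RRm q 1) (RRm q 2) (RRm q 4)
    / (RRm q 1 ^+ 4 * RRm q 2 * RRm q 4 ^+ 2).
Proof.
have qn n : q ^+ n != 0 by rewrite expf_neq0.
have qlt n : (0 < n)%N -> `|q ^+ n| < 1 by exact: q_exp_lt1.
have nz n : (0 < n)%N -> RR (q ^+ n) != 0.
  by move=> n0; apply: RR_neq0 => //; exact: qlt.
rewrite /RRm expr1 eta_quotient mulrA -expr2; apply: P_algebra => //.
- by have := nz 1%N isT; rewrite expr1.
- exact: nz.
- exact: nz.
- exact: RR_modular2.
(* [m] is [k] with [q ^+ 2] in place of [q], so the second relation is the first one at [q ^+ 2]. *)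
- have := RR_modular2 cC (qn 2%N) (qlt 2%N isT).
  by rewrite -exprM.
- exact: RR_level20.
Qed.
End RogersRamanujan.

Local Open Scope complex_scope.

Theorem theorem1p1 (R : realType) (q : R[i])
    (hq0 : 0 < `|q|) (hq1 : `|q| < 1) :
  q * (qpoch q q ^+ 6 / qpoch (q ^+ 5) (q ^+ 5) ^+ 6) =
  P q (RRm q 1) (RRm q 2) (RRm q 4)
    / (RRm q 1 ^+ 4 * RRm q 2 * RRm q 4 ^+ 2).
Proof.
(* [sqrtCK] supplies the square root [s] of [q]. *)
apply: (eta_quotient_RR (@complex_abs_complete R) (sqrtCK q)) => //.
by rewrite -normr_gt0.
Qed.
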